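(* For $x,y\in\mathbb{R}$ and $t>0$ let $$F(x,y,t)=\int_0^t f^*\big(f'(h(x-y,t)e^{\beta(\theta)})\big)e^{-\beta(\theta)}\,d\theta+\int_0^y u_0(z)\,dz .$$ Then for almost every $(x,t)\in\mathbb{R}\times(0,\infty)$ the functional $y\mapsto F(x,y,t)$ attains its minimum over $\mathbb{R}$ at a unique point $y(x,t)$, and the function $u(x,t)=h(x-y^*(x,t),t)\,e^{\beta(t)}$ satisfies, for every $\phi\in C_c^\infty(\mathbb{R}\times[0,\infty))$, $$\int_0^\infty\int_{-\infty}^\infty\big[u\,\phi_t+f(u)\,\phi_x\big]\,dx\,dt+\int_{-\infty}^\infty u_0(x)\phi(x,0)\,dx=-\int_0^\infty\int_{-\infty}^\infty\alpha(t)\,u(x,t)\,\phi(x,t)\,dx\,dt .$$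
   Context: Standing assumptions: $f\in C^2(\mathbb{R};\mathbb{R})$ is strictly convex with superlinear growth, i.e. $\lim_{|v|\to\infty}f(v)/|v|=\infty$; $\alpha\in L^\infty([0,\infty);\mathbb{R})$; $u_0:\mathbb{R}\to\mathbb{R}$ is a bounded measurable function. Put $\beta(t)=\int_0^t\alpha(s)\,ds$. The Legendre transform of $f$ is $f^*(p)=\sup_{v\in\mathbb{R}}\{pv-f(v)\}$. The function $h:\mathbb{R}\times(0,\infty)\to\mathbb{R}$ is defined as follows: $h(x,t)$ is the unique $q\in\mathbb{R}$ with $\int_0^t f'(q\,e^{\beta(\theta)})\,d\theta=x$. For $x\in\mathbb{R}$, $t>0$, $y^*(x,t)=\max\{y\in\mathbb{R}:F(x,y,t)=\min_{z\in\mathbb{R}}F(x,z,t)\}$ is the largest minimizer of $F(x,\cdot,t)$. *)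

(* Defs.v *)
From HB Require Import structures.
From mathcomp Require Import all_boot all_order all_algebra.
From mathcomp Require Import all_classical all_reals all_analysis.

Set Implicit Arguments.
Unset Strict Implicit.
Unset Printing Implicit Defensive.

Import Order.TTheory GRing.Theory Num.Theory.
Import numFieldNormedType.Exports.

Local Open Scope classical_set_scope.
Local Open Scope ring_scope.

(* The library's [lebesgue_measure] only sees Borel sets. The Caratheodory type
   below is R with the Lebesgue sigma-algebra, the domain of
   [completed_lebesgue_measure]. *)
Definition lebesgue_measurable_fun (R : realType) (D : set R) (f : R -> R) :=
  measurable_fun (D : set (caratheodory_type (@wlength R idfun)^*%mu)) f.

Definition lebesgue_integral (R : realType) (D : set R) (f : R -> R) : R :=
  Rintegral (@completed_lebesgue_measure R) D f.

Notation "\lint_ ( x 'in' D ) F" := (lebesgue_integral D (fun x => F))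
  (at level 36, F at level 36, x name, D at level 50,
   format "'[' \lint_ ( x  'in'  D ) '/  '  F ']'") : ring_scope.

Section ScalarBalanceLaw.
Variable R : realType.
Implicit Types (f alpha beta g : R -> R) (x y t q v : R).

Definition C2 f :=
  [/\ forall v, derivable f v 1, forall v, derivable (derive1 f) v 1 &
      continuous (derive1 (derive1 f))].

Definition strictly_convex f := forall v w s, v != w -> 0 < s < 1 ->
  f (s * v + (1 - s) * w) < s * f v + (1 - s) * f w.

Definition superlinear f :=
  (f v / `|v| @[v --> +oo] --> +oo) /\ (f v / `|v| @[v --> -oo] --> +oo).

Definition Linfty_halfline alpha :=
  (alpha \_ `[0, +oo[) \in Lfun (@completed_lebesgue_measure R) +oo%E.

(* \int_0^y g(z) dz, also for y < 0 *)
Definition oriented_integral g y : R :=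
  if 0 <= y then \lint_(z in `[0, y]) g z else - \lint_(z in `[y, 0]) g z.

Definition primitive alpha t : R := \lint_(s in `[0, t]) alpha s.

(* a real supremum: it is the true one as soon as f has superlinear growth *)
Definition legendre f p : R := sup (range (fun v => p * v - f v)).

(* hfun and ystar pick the point designated by a description; [get] returns a
   default value where the description fails, e.g. for hfun at t <= 0. *)
Definition hfun f beta x t : R :=
  get [set q | \lint_(th in `[0, t]) derive1 f (q * expR (beta th)) = x].

Definition Ffun f beta (u0 : R -> R) x y t : R :=
  \lint_(th in `[0, t])
     (legendre f (derive1 f (hfun f beta (x - y) t * expR (beta th)))
      * expR (- beta th))
  + oriented_integral u0 y.

Definition is_minimizer g y := forall z, g y <= g z.

Definition ystar f beta (u0 : R -> R) x t : R :=
  get [set y | is_minimizer (fun z => Ffun f beta u0 x z t) y /\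
    forall z, is_minimizer (fun z' => Ffun f beta u0 x z' t) z -> z <= y].

Definition ufun f beta (u0 : R -> R) x t : R :=
  hfun f beta (x - ystar f beta u0 x t) t * expR (beta t).

Definition upper_half : set (R * R) := [set p | 0 <= p.2].

(* C^n up to the boundary on R x [0, +oo[: the partial derivatives of order
   at most n exist for t > 0 and extend continuously to t = 0.
   Values at t < 0 play no role. *)
Fixpoint Cn_half (n : nat) (phi : R * R -> R) : Prop :=
  {within upper_half, continuous phi} /\
  if n is m.+1 then
    exists phix phit : R * R -> R,
      [/\ forall x t, 0 < t -> is_derive x 1 (fun z => phi (z, t)) (phix (x, t)),
          forall x t, 0 < t -> is_derive t 1 (fun s => phi (x, s)) (phit (x, t)),
          Cn_half m phix & Cn_half m phit]
  else True.

Definition test_function (phi : R * R -> R) :=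
  (forall n, Cn_half n phi) /\
  compact (closure (upper_half `&` [set p | phi p != 0])).

End ScalarBalanceLaw.

(* Main.v *)
Require Import Defs.
From HB Require Import structures.
From mathcomp Require Import all_boot all_order all_algebra.
From mathcomp Require Import all_classical all_reals all_analysis.
From mathcomp Require Import measurable_realfun ess_sup_inf hoelder ring lra.
Set Implicit Arguments.
Unset Strict Implicit.
Unset Printing Implicit Defensive.
Import Order.TTheory GRing.Theory Num.Theory.
Import numFieldNormedType.Exports.
Local Open Scope classical_set_scope.
Local Open Scope ring_scope.

(** The balance law is the derivative in [x] of a Hamilton-Jacobi equation, and
    the minimised functional is the value function of that equation.

    Write [beta] for the primitive of [alpha] and put
    [K q t = \int_0^t f(q e^beta) e^-beta], [G q t = \int_0^t f'(q e^beta)].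
    Integrating the tangent inequality of [f] gives
    [K q t + G q t (p - q) <= K p t], so [G] is the slope of the convex function
    [K], and by superlinear growth it is a bijection in [q] for each [t > 0],
    with inverse [h]. Since [f* (f' v) = v f' v - f v], the functional is
    [F x y t = A (x - y) t + U y], where [U] is the primitive of [u0] and
    [A z t = h z t * z - K (h z t) t = max_q (q z - K q t)] is the Legendre
    transform of [K]. As a maximum, [A] satisfies
    [h z (z' - z) <= A z' - A z] in space, and in time its increments lie between
    those of [- K (h z t)] and [- K (h z t')]; hence its derivatives are [h] and
    [- f(h e^beta) e^-beta]. [U] is Lipschitz and [A] is superlinear, so
    minimisers exist, and the slope [h] at a minimiser is at most the bound of
    [u0].

    Uniqueness. [A] is strictly convex in space, so minimisers are monotone in
    [x]: an interval [[r, r']] separates two minimisers at one point [x] at most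
    (straddling_subsingleton). For fixed [t] the exceptional points are therefore
    countable, and rational intervals cover the exceptional set of the half-plane
    by countably many Borel sets whose sections at constant [t] have at most one
    point (ae_unique_minimizer).

    The equation. Let [V x t] be the minimum and [w x t = h (x - ystar x t) t].
    Wherever the minimiser is unique it depends continuously on the data, and the
    two one-sided comparisons of [V] with the cost at a frozen minimiser give
    [V_x = w] and [V_t = - f(w e^beta) e^-beta] (value_is_derive,
    cvg_value_time_quotient). Uniqueness holds for every [t > 0] at almost every
    [x], and difference quotients of [V] are bounded, so by dominated convergence
    [W t = \int w phi dx = - \int V phi_x dx] is differentiable at every [t > 0],
    with derivative [\int (w phi_t + f(w e^beta) e^-beta phi_x) dx], which is
    continuous in [t] (pairing_is_derive, flux_pairing_continuous). Moreover
    [V x t -> U x] uniformly as [t -> 0], so [W t -> \int u0 phi(x,0) dx].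

    As [u = w e^beta], the left-hand side of the weak formulation contains the
    integral of [e^beta W'], and integration by parts in [t] yields the initial
    term and the source term. The weight [e^beta] has a derivative almost
    everywhere only; differentiating it is replaced by the following remark: if
    [p] is continuous at [x] and [g] is locally bounded, then
    [y |-> \int_0^y g p - p x \int_0^y g] has derivative zero at [x]
    (is_derive_oriented_integralM). Subtracting [\int alpha e^beta W] from
    [e^beta W] thus leaves a function with the continuous derivative
    [e^beta W'] on [t > 0] (weak_identity). *)

(** * Lebesgue integrals over intervals *)

Section IntervalIntegral.
Variable R : realType.
Implicit Types (f g p : R -> R) (a b c x y : R).

Notation mu := (@completed_lebesgue_measure R).
Notation LT := (caratheodory_type (@wlength R idfun)^*%mu).

Lemma borel_lebesgue_measurable (A : set R) :
  measurable A -> measurable (A : set LT).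
Proof. exact: sub_caratheodory. Qed.

(** Closed under products and compositions with continuous functions, and integrable
    on every segment: one hypothesis for [u0], [alpha] and all continuous integrands. *)
Definition locbdd_meas g := lebesgue_measurable_fun setT g /\
  forall r : R, exists C : R, forall x : R, `|x| <= r -> `|g x| <= C.

Lemma locbdd_meas_borel g : measurable_fun setT g ->
  (forall r : R, exists C : R, forall x : R, `|x| <= r -> `|g x| <= C) -> locbdd_meas g.
Proof.
move=> mg bg; split => // _ B mB; apply: borel_lebesgue_measurable.
exact: (mg measurableT B mB).
Qed.

Lemma continuous_locbdd g : continuous g ->
  forall r : R, exists C : R, forall x : R, `|x| <= r -> `|g x| <= C.
Proof.
move=> cg r; have := @segment_compact _ (- r) r.
move/(continuous_compact (continuous_subspaceT cg))/compact_bounded.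
move=> [M [_ /(_ (M + 1))]]; rewrite ltrDl ltr01 => /(_ isT) H.
by exists (M + 1) => x; rewrite ler_norml => xr; apply: H; exists x => //=; rewrite in_itv.
Qed.

Lemma locbdd_meas_continuous g : continuous g -> locbdd_meas g.
Proof.
move=> cg; apply: locbdd_meas_borel; last exact: continuous_locbdd.
exact: continuous_measurable_fun.
Qed.

Lemma locbdd_measD f g : locbdd_meas f -> locbdd_meas g ->
  locbdd_meas (fun x => f x + g x).
Proof.
move=> [mf bf] [mg bg]; split; first exact: measurable_funD.
move=> r; have [C fC] := bf r; have [D gD] := bg r; exists (C + D) => x xr.
by rewrite (le_trans (ler_normD _ _))// lerD// (fC, gD).
Qed.

Lemma locbdd_measM f g : locbdd_meas f -> locbdd_meas g ->
  locbdd_meas (fun x => f x * g x).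
Proof.
move=> [mf bf] [mg bg]; split; first exact: measurable_funM.
move=> r; have [C fC] := bf r; have [D gD] := bg r; exists (C * D) => x xr.
by rewrite normrM ler_pM// (fC, gD).
Qed.

Lemma locbdd_meas_cst c : locbdd_meas (fun=> c).
Proof. by apply: locbdd_meas_continuous => x; exact: cvg_cst. Qed.

Lemma locbdd_meas_comp f g : continuous f -> locbdd_meas g ->
  locbdd_meas (fun x => f (g x)).
Proof.
move=> cf [mg bg]; split.
  by apply: measurableT_comp mg; exact: continuous_measurable_fun.
move=> r; have [C gC] := bg r; have [D fD] := continuous_locbdd cf C.
by exists D => x xr; exact: fD (gC _ xr).
Qed.

Lemma locbdd_measN g : locbdd_meas g -> locbdd_meas (fun x => - g x).
Proof. by move=> ?; apply: (@locbdd_meas_comp -%R) => //; exact: opp_continuous. Qed.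

Lemma locbdd_measB f g : locbdd_meas f -> locbdd_meas g ->
  locbdd_meas (fun x => f x - g x).
Proof. by move=> ? ?; apply: locbdd_measD => //; exact: locbdd_measN. Qed.

Lemma locbdd_measZ c g : locbdd_meas g -> locbdd_meas (fun x => c * g x).
Proof. by apply: locbdd_measM; exact: locbdd_meas_cst. Qed.

Lemma measurable_itv_lebesgue (i : interval R) : measurable ([set` i] : set LT).
Proof. exact: borel_lebesgue_measurable. Qed.

Lemma integrable_segment g a b : locbdd_meas g ->
  mu.-integrable `[a, b] (EFin \o g).
Proof.
move=> [mg bg]; apply: measurable_bounded_integrable.
- exact: measurable_itv_lebesgue.
- rewrite -[X in (X < _)%E]/(lebesgue_measure `[a, b]%classic).
  by rewrite lebesgue_measure_itv/=; case: ifP => // _; rewrite -EFinB ltry.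
- exact: measurable_funS mg.
have [C gC] := bg (`|a| + `|b|).
exists C; split; first exact: num_real.
move=> D CD x /=; rewrite in_itv/= => /andP[ax xb].
apply: (le_trans (gC _ _) (ltW CD)).
rewrite ler_norml; have := ler_norm b; have := ler_norm (- a).
have := normr_ge0 a; have := normr_ge0 b; rewrite normrN; lra.
Qed.

Lemma lint_set1 g a : locbdd_meas g -> \lint_(x in [set a]) g x = 0.
Proof.
move=> [mg _]; rewrite /lebesgue_integral /Rintegral.
suff -> : (\int[mu]_(x in [set a]) (g x)%:E)%E = 0%E by [].
apply: null_set_integral.
- by rewrite -set_itv1; exact: measurable_itv_lebesgue.
- by apply/measurable_EFinP; exact: measurable_funS mg.
- exact: (lebesgue_measure_set1 a).
Qed.

Lemma lint_segment_cat g a b c : locbdd_meas g -> a <= b -> b <= c ->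
  \lint_(x in `[a, c]) g x = \lint_(x in `[a, b]) g x + \lint_(x in `[b, c]) g x.
Proof.
move=> mg ab bc; rewrite /lebesgue_integral.
have igac := integrable_segment a c mg; have igbc := integrable_segment b c mg.
have Ebc : `[b, c]%classic = [set b] `|` `]b, c].
  by rewrite setU1itv// bnd_simp.
have mb : measurable ([set b] : set LT).
  by rewrite -set_itv1; exact: measurable_itv_lebesgue.
have -> : Rintegral mu `[b, c] g = Rintegral mu `]b, c] g.
  rewrite [in LHS]Ebc Rintegral_setU//.
  - by rewrite [X in X + _]lint_set1// add0r.
  - exact: measurable_itv_lebesgue.
  - by rewrite -Ebc.
  - by apply/disj_setPS => y [/= ->]; rewrite in_itv/= ltxx.
have Eac : `[a, c]%classic = `[a, b] `|` `]b, c].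
  by rewrite -itv_bndbnd_setU// bnd_simp.
rewrite [in LHS]Eac Rintegral_setU//.
- exact: measurable_itv_lebesgue.
- exact: measurable_itv_lebesgue.
- by rewrite -Eac.
- by apply/disj_setPS => y [/=]; rewrite !in_itv/= => /andP[_ yb] /andP[]; rewrite ltNge yb.
Qed.

Lemma oriented_integralB g a b : locbdd_meas g -> a <= b ->
  oriented_integral g b - oriented_integral g a = \lint_(x in `[a, b]) g x.
Proof.
move=> mg ab; rewrite /oriented_integral.
have [a0|a0] := leP 0 a.
  rewrite (le_trans a0 ab) (@lint_segment_cat g 0 a b)//; lra.
have [b0|b0] := leP 0 b.
  by rewrite (@lint_segment_cat g a 0 b)//; lra.
rewrite (@lint_segment_cat g a b 0)//; lra.
Qed.

Lemma lint_segment1 g a : locbdd_meas g -> \lint_(x in `[a, a]) g x = 0.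
Proof. by move=> mg; rewrite -oriented_integralB// subrr. Qed.

Lemma oriented_integral0 g : locbdd_meas g -> oriented_integral g 0 = 0.
Proof. by move=> mg; rewrite /oriented_integral lexx lint_segment1. Qed.

Lemma lintD_segment f g a b : locbdd_meas f -> locbdd_meas g ->
  \lint_(x in `[a, b]) (f x + g x) =
  \lint_(x in `[a, b]) f x + \lint_(x in `[a, b]) g x.
Proof.
by move=> mf mg; apply: RintegralD;
  [exact: measurable_itv_lebesgue|exact: integrable_segment..].
Qed.

Lemma lintZ_segment c g a b : locbdd_meas g ->
  \lint_(x in `[a, b]) (c * g x) = c * \lint_(x in `[a, b]) g x.
Proof.
by move=> mg; apply: RintegralZl;
  [exact: measurable_itv_lebesgue|exact: integrable_segment..].
Qed.

Lemma lintN_segment g a b : locbdd_meas g ->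
  \lint_(x in `[a, b]) (- g x) = - \lint_(x in `[a, b]) g x.
Proof.
move=> mg; rewrite -mulN1r -lintZ_segment//.
by apply: eq_Rintegral => x _; rewrite mulN1r.
Qed.

Lemma lint_subr_segment f g a b : locbdd_meas f -> locbdd_meas g ->
  \lint_(x in `[a, b]) (f x - g x) =
  \lint_(x in `[a, b]) f x - \lint_(x in `[a, b]) g x.
Proof.
by move=> mf mg; rewrite lintD_segment ?lintN_segment//; exact: locbdd_measN.
Qed.

Lemma lint_cst_segment c a b : a <= b -> \lint_(x in `[a, b]) c = c * (b - a).
Proof.
move=> ab; rewrite /lebesgue_integral Rintegral_cst; last first.
  exact: measurable_itv_lebesgue.
rewrite -[X in fine X]/(lebesgue_measure `[a, b]%classic).
rewrite lebesgue_measure_itv/= lte_fin; case: ltgtP ab => //= ab _.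
by rewrite ab subrr.
Qed.

Lemma le_lint_segment f g a b : locbdd_meas f -> locbdd_meas g ->
  (forall x, a <= x <= b -> f x <= g x) ->
  \lint_(x in `[a, b]) f x <= \lint_(x in `[a, b]) g x.
Proof.
move=> mf mg fg; apply: le_Rintegral.
- exact: measurable_itv_lebesgue.
- exact: integrable_segment.
- exact: integrable_segment.
- by move=> x; rewrite /= in_itv; exact: fg.
Qed.

Lemma lint_segment_le_cst g a b c : locbdd_meas g -> a <= b ->
  (forall x, a <= x <= b -> g x <= c) -> \lint_(x in `[a, b]) g x <= c * (b - a).
Proof.
move=> mg ab gc; rewrite -lint_cst_segment//.
by apply: le_lint_segment => //; exact: locbdd_meas_cst.
Qed.

Lemma norm_lint_segment_le g a b c : locbdd_meas g -> a <= b ->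
  (forall x, a <= x <= b -> `|g x| <= c) ->
  `|\lint_(x in `[a, b]) g x| <= c * (b - a).
Proof.
move=> mg ab gc; rewrite ler_norml lerNl -lintN_segment//.
apply/andP; split; apply: lint_segment_le_cst => //.
- exact: locbdd_measN.
- by move=> x /gc; apply: le_trans; rewrite -normrN ler_norm.
- by move=> x /gc; apply: le_trans; rewrite ler_norm.
Qed.

Lemma norm_oriented_integralB_le g x y c : locbdd_meas g ->
  (forall z, `|z - x| <= `|y - x| -> `|g z| <= c) ->
  `|oriented_integral g y - oriented_integral g x| <= c * `|y - x|.
Proof.
move=> mg gc; have [xy|yx] := leP x y.
  rewrite oriented_integralB// [`|y - x|]ger0_norm ?subr_ge0//.
  apply: norm_lint_segment_le => // z xzy; apply: gc.
  by rewrite !ger0_norm; lra.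
have yx' := ltW yx.
rewrite distrC oriented_integralB// [`|y - x|]ltr0_norm ?subr_lt0// opprB.
apply: norm_lint_segment_le => //.
by move=> z xzy; apply: gc; rewrite !ler0_norm; lra.
Qed.

Lemma oriented_integralD f g x : locbdd_meas f -> locbdd_meas g ->
  oriented_integral (fun z => f z + g z) x =
  oriented_integral f x + oriented_integral g x.
Proof.
by move=> mf mg; rewrite /oriented_integral !lintD_segment//; case: ifP => // _; ring.
Qed.

Lemma oriented_integralZ c g x : locbdd_meas g ->
  oriented_integral (fun z => c * g z) x = c * oriented_integral g x.
Proof.
by move=> mg; rewrite /oriented_integral !lintZ_segment//; case: ifP => // _; ring.
Qed.

Lemma oriented_integral_subr f g x : locbdd_meas f -> locbdd_meas g ->
  oriented_integral (fun z => f z - g z) x =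
  oriented_integral f x - oriented_integral g x.
Proof.
by move=> mf mg; rewrite /oriented_integral !lint_subr_segment//; case: ifP => // _; ring.
Qed.

End IntervalIntegral.

(** * Derivatives of primitives and integration by parts *)

Section Derivative.
Variable R : realType.
Implicit Types (f g p G W : R -> R) (a b c x y l : R).

Lemma is_derive_epsP f x l : is_derive x 1 f l <->
  forall e, 0 < e -> exists2 d, 0 < d &
    forall y, `|y - x| < d -> `|f y - f x - l * (y - x)| <= e * `|y - x|.
Proof.
have E : (h^-1 *: ((f \o shift x) (h *: 1) - f x) @[h --> 0^'] --> l) <->
  forall e, 0 < e -> exists2 d, 0 < d &
    forall y, `|y - x| < d -> `|f y - f x - l * (y - x)| <= e * `|y - x|.
  split=> [|H].
    move/cvgrPdist_le => H e /H; rewrite near_withinE => /nbhs_ballP[d /= d0 dH].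
    exists d => // y yd; have [->|yx] := eqVneq y x.
      by rewrite !subrr mulr0 subrr !normr0 mulr0.
    have yx0 : y - x != 0 by rewrite subr_eq0.
    have := dH (y - x); rewrite /ball/= sub0r normrN => /(_ yd yx0).
    rewrite [_ *: 1]mulr1 subrK => h.
    rewrite -[X in `|X| <= _](_ : - (y - x) * (l - (y - x)^-1 *: (f y - f x)) = _).
      by rewrite normrM normrN mulrC ler_wpM2r.
    by rewrite /GRing.scale/=; field.
  apply/cvgrPdist_le => e /H[d d0 dH]; rewrite near_withinE.
  apply/nbhs_ballP; exists d => //= h; rewrite /ball/= sub0r normrN => hd h0.
  have := dH (h + x); rewrite addrK => /(_ hd) {}dH.
  rewrite [_ *: 1]mulr1 -(ler_pM2r (_ : 0 < `|h|)) ?normr_gt0//.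
  apply: le_trans dH; rewrite -normrM -normrN.
  rewrite le_eqVlt; apply/orP; left; apply/eqP; congr Num.norm.
  by rewrite /GRing.scale/=; field.
split=> [[df fl]|].
  by apply/E; rewrite -fl; exact: df.
move=> /E H; apply: DeriveDef; first by apply/cvg_ex; exists l.
exact: cvg_lim H.
Qed.

Lemma is_derive_cont f x l : is_derive x 1 f l -> {for x, continuous f}.
Proof. by move=> [df _]; apply/differentiable_continuous/derivable1_diffP. Qed.

Lemma cvgr_ballP f x l : (f y @[y --> x] --> l) <->
  forall e, 0 < e -> exists2 d, 0 < d & forall y, `|y - x| < d -> `|f y - l| <= e.
Proof.
split=> [/cvgrPdist_le H e /H /nbhs_ballP[d /= d0 dH]|H].
  by exists d => // y yd; rewrite distrC; apply: dH; rewrite /ball/= distrC.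
apply/cvgrPdist_le => e /H[d d0 dH]; apply/nbhs_ballP; exists d => //= y.
by rewrite /ball/= distrC [`|l - _|]distrC; exact: dH.
Qed.

(** Continuity at the single point [x] suffices; this is what makes
    is_derive_oriented_integralM possible. *)
Lemma is_derive_oriented_integral g x : locbdd_meas g ->
  {for x, continuous g} -> is_derive x 1 (oriented_integral g) (g x).
Proof.
move=> mg /cvgr_ballP cg; apply/is_derive_epsP => e /cg[d d0 dg].
exists d => // y yd.
have mg' : locbdd_meas (fun z => g z - g x).
  by apply: locbdd_measB => //; exact: locbdd_meas_cst.
have oc z : oriented_integral (fun=> g x) z = g x * z.
  rewrite /oriented_integral; case: leP => z0; rewrite lint_cst_segment ?subr0//.
    by rewrite sub0r mulrN opprK.
  exact: ltW.
have := @norm_oriented_integralB_le _ _ x y e mg' _.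
rewrite !oriented_integral_subr//; do ?exact: locbdd_meas_cst.
rewrite !oc => H; apply: le_trans (H _).
  by rewrite le_eqVlt; apply/orP; left; apply/eqP; congr Num.norm; ring.
by move=> z zx; apply: dg; exact: le_lt_trans yd.
Qed.

(** The function is the primitive of [g (p - p x)], which is continuous at [x] with
    value zero because [g] is bounded near [x]. It replaces the differentiation of
    [oriented_integral g], which may fail at [x]. *)
Lemma is_derive_oriented_integralM g p x : locbdd_meas g -> locbdd_meas p ->
  {for x, continuous p} ->
  is_derive x 1 (fun y => oriented_integral (fun z => g z * p z) y
                          - p x * oriented_integral g y) 0.
Proof.
move=> mg mp /cvgr_ballP cp.
have mgp : locbdd_meas (fun z => g z * (p z - p x)).
  by apply: locbdd_measM => //; apply: locbdd_measB => //; exact: locbdd_meas_cst.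
rewrite (_ : (fun y => _) = oriented_integral (fun z => g z * (p z - p x))); last first.
  apply/funext => y; rewrite -oriented_integralZ// -oriented_integral_subr.
  - by congr (oriented_integral _ _); apply/funext => z; ring.
  - exact: locbdd_measM.
  - exact: locbdd_measZ.
rewrite -[X in is_derive _ _ _ X](_ : g x * (p x - p x) = _); last by rewrite subrr mulr0.
apply: is_derive_oriented_integral => //; apply/cvgr_ballP => e e0.
have [C gC] := mg.2 (`|x| + 1).
have C0 : 0 <= C by apply: le_trans (gC 0 _) => //; rewrite normr0 addr_ge0.
have C1 : 0 < C + 1 by lra.
have [d d0 dp] := cp (e / (C + 1)) (divr_gt0 e0 C1).
exists (Num.min d 1); first by rewrite lt_min d0 ltr01.
move=> y; rewrite lt_min => /andP[yd y1].
rewrite subrr mulr0 subr0 normrM.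
have yx1 : `|y| <= `|x| + 1.
  rewrite -[y](subrK x) addrC (le_trans (ler_normD _ _))// lerD2l; exact: ltW.
apply: (@le_trans _ _ ((C + 1) * (e / (C + 1)))); last by rewrite mulrC divfK// gt_eqF.
by apply: ler_pM => //; [have := gC _ yx1; lra|exact: dp].
Qed.

Lemma is_derive_continuousM G p x dp : {for x, continuous G} ->
  is_derive x 1 p dp -> p x = 0 -> is_derive x 1 (fun y => G y * p y) (G x * dp).
Proof.
move=> /cvgr_ballP cG /is_derive_epsP dpP px0; apply/is_derive_epsP => e e0.
have e20 : 0 < e / 2 by lra.
have G1 : 0 < `|G x| + 1 by have := normr_ge0 (G x); lra.
have d1 : 0 < `|dp| + 1 by have := normr_ge0 dp; lra.
have [a a0 aG] := cG _ ltr01.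
have [b b0 bG] := cG _ (divr_gt0 e20 d1).
have [c c0 cp] := dpP _ (divr_gt0 e20 G1).
exists (Num.min a (Num.min b c)); first by rewrite !lt_min a0 b0 c0.
move=> y; rewrite !lt_min => /and3P[ya yb yc].
have {}aG := aG _ ya; have {}bG := bG _ yb; have {}cp := cp _ yc.
rewrite px0 mulr0 subr0.
rewrite (_ : _ - _ = G y * (p y - p x - dp * (y - x)) +
    (G y - G x) * dp * (y - x)); last first.
  by rewrite px0; ring.
apply: le_trans (ler_normD _ _) _; rewrite !normrM.
have Gy : `|G y| <= `|G x| + 1.
  by rewrite -[G y](subrK (G x)) (le_trans (ler_normD _ _))// addrC lerD2l.
have h1 : `|G y| * `|p y - p x - dp * (y - x)| <=
    (`|G x| + 1) * (e / 2 / (`|G x| + 1) * `|y - x|) by apply: ler_pM.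
have h2 : `|G y - G x| * `|dp| * `|y - x| <=
    (e / 2 / (`|dp| + 1)) * (`|dp| + 1) * `|y - x|.
  by rewrite ler_wpM2r// ler_pM//; lra.
apply: le_trans (lerD h1 h2) _.
rewrite mulrA [(_ + 1) * _]mulrC divfK ?gt_eqF// divfK ?gt_eqF//.
by rewrite -mulrDl -splitr.
Qed.

Lemma is_derive0_comp_lipschitz (psi : R -> R) G x C :
  (exists2 d, 0 < d & forall y, `|y - x| < d -> `|G y - G x| <= C * `|y - x|) ->
  is_derive (G x) 1 psi 0 -> is_derive x 1 (fun y => psi (G y)) 0.
Proof.
move=> [d d0 dG] /is_derive_epsP H; apply/is_derive_epsP => e e0.
have C1 : 0 < `|C| + 1 by have := normr_ge0 C; lra.
have [c c0 cH] := H _ (divr_gt0 e0 C1).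
exists (Num.min d (c / (`|C| + 1))); first by rewrite lt_min d0 divr_gt0.
move=> y; rewrite lt_min => /andP[yd yc]; have {}dG := dG _ yd.
have GC : `|G y - G x| <= (`|C| + 1) * `|y - x|.
  by apply: le_trans dG _; rewrite ler_wpM2r//; have := ler_norm C; lra.
rewrite mul0r subr0; have := cH (G y); rewrite mul0r subr0 => h.
apply: le_trans (h _) _.
  by apply: le_lt_trans GC _; rewrite mulrC -ltr_pdivlMr.
apply: le_trans (ler_wpM2l _ GC) _; first by rewrite divr_ge0// ltW.
by rewrite mulrA divfK ?gt_eqF.
Qed.

Lemma eq_of_is_derive0 f a b : a <= b ->
  (forall x, a < x < b -> is_derive x 1 f 0) ->
  (forall x, a <= x <= b -> {for x, continuous f}) -> f a = f b.
Proof.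
move=> ab df cf.
have df' x : x \in `]a, b[ -> is_derive x 1 f 0 by rewrite in_itv; exact: df.
have cf' : {within `[a, b], continuous f}.
  by apply: continuous_in_subspaceT => x; rewrite inE/= in_itv; exact: cf.
have [c _ /eqP] := MVT_segment ab df' cf'.
by rewrite mul0r subr_eq0 => /eqP.
Qed.

Lemma oriented_integral_lipschitz g x : locbdd_meas g -> exists C : R,
  exists2 d, 0 < d & forall y, `|y - x| < d ->
    `|oriented_integral g y - oriented_integral g x| <= C * `|y - x|.
Proof.
move=> mg; have [C gC] := mg.2 (`|x| + 1); exists C, 1 => // y yx.
apply: norm_oriented_integralB_le => // z zy; apply: gC.
rewrite -[z](subrK x) (le_trans (ler_normD _ _))// addrC lerD2l.
by rewrite (le_trans zy)// ltW.
Qed.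

Lemma continuous_oriented_integral g : locbdd_meas g ->
  continuous (oriented_integral g).
Proof.
move=> mg x; apply/cvgr_ballP => e e0.
have [C [d d0 dC]] := oriented_integral_lipschitz x mg.
have C1 : 0 < `|C| + 1 by have := normr_ge0 C; lra.
exists (Num.min d (e / (`|C| + 1))); first by rewrite lt_min d0 divr_gt0.
move=> y; rewrite lt_min => /andP[/dC yd]; rewrite ltr_pdivlMr// => yc.
apply: le_trans yd (le_trans _ (ltW yc)).
by rewrite mulrC ler_wpM2l//; have := ler_norm C; lra.
Qed.

(** [D] itself may fail to be differentiable at [x]: only the combination with the
    frozen coefficient [p x] has to be. *)
Lemma is_derive_sub_oriented_integralM g p D x l : locbdd_meas g ->
  locbdd_meas p -> {for x, continuous p} ->
  is_derive x 1 (fun y => D y - p x * oriented_integral g y) l ->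
  is_derive x 1 (fun y => D y - oriented_integral (fun z => g z * p z) y) l.
Proof.
move=> mg mp cp dD; have := is_deriveB dD (is_derive_oriented_integralM mg mp cp).
by rewrite subr0; congr (is_derive _ _ _ _); apply/funext => y; rewrite !fctE opprB addrA subrK.
Qed.

(** [G p - \int g p] has derivative [G dp] everywhere, although [G] is merely Lipschitz. *)
Lemma lint_by_parts g p dp c a b : locbdd_meas g -> a <= b ->
  (forall x, is_derive x 1 p (dp x)) -> continuous dp ->
  let G x := c + oriented_integral g x in
  \lint_(x in `[a, b]) (G x * dp x) =
  G b * p b - G a * p a - \lint_(x in `[a, b]) (g x * p x).
Proof.
move=> mg ab dpP cdp G.
have cp : continuous p by move=> x; exact: is_derive_cont (dpP x).
have cG : continuous G.
  by move=> x; apply: cvgD; [exact: cvg_cst|exact: continuous_oriented_integral].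
have mp := locbdd_meas_continuous cp.
have cGdp : continuous (fun x => G x * dp x).
  by move=> x; apply: cvgM; [exact: cG|exact: cdp].
have mGdp := locbdd_meas_continuous cGdp.
have mgp : locbdd_meas (fun x => g x * p x) by exact: locbdd_measM.
rewrite -!oriented_integralB//.
set D := fun y => (G y * p y - oriented_integral (fun x => g x * p x) y)
                  - oriented_integral (fun x => G x * dp x) y.
suff dD y : is_derive y 1 D 0.
  by have := is_derive_0_is_cst a b dD; rewrite /D; lra.
have d1 : is_derive y 1 (fun z => G z * p z - oriented_integral (fun x => g x * p x) z)
    (G y * dp y).
  apply: is_derive_sub_oriented_integralM => //; first exact: cp.
  have d2 : is_derive y 1 (fun z => p z - p y) (dp y).
    have := is_deriveB (dpP y) (is_derive_cst (p y) y 1); rewrite subr0.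
    by congr (is_derive _ _ _ _).
  have d3 := is_derive_continuousM (cG y) d2 (subrr _).
  have := is_deriveD d3 (is_derive_cst (p y * c) y 1); rewrite addr0.
  by congr (is_derive _ _ _ _); apply/funext => z; rewrite !fctE /G /cst; ring.
have := is_deriveB d1 (is_derive_oriented_integral mGdp (cGdp y)).
by rewrite subrr; congr (is_derive _ _ _ _).
Qed.

Lemma lint_dominated (g_ : nat -> R -> R) g a b (N : set R) (C : R) :
  (forall n, locbdd_meas (g_ n)) -> locbdd_meas g ->
  (@completed_lebesgue_measure R).-negligible N ->
  (forall x, a <= x <= b -> ~ N x -> g_ n x @[n --> \oo] --> g x) ->
  (forall n x, a <= x <= b -> `|g_ n x| <= C) ->
  \lint_(x in `[a, b]) g_ n x @[n --> \oo] --> \lint_(x in `[a, b]) g x.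
Proof.
move=> mg_ mg [M [mM M0 NM]] g_g gC.
have igx f : locbdd_meas f -> (@completed_lebesgue_measure R).-integrable `[a, b] (EFin \o f).
  by move=> ?; exact: integrable_segment.
have [] := @dominated_convergence _ _ R (@completed_lebesgue_measure R) `[a, b]%classic
  (measurable_itv_lebesgue _) (fun n x => (g_ n x)%:E) (fun x => (g x)%:E) (fun=> C%:E).
- by move=> n; exact: measurable_int (igx _ (mg_ n)).
- exact: measurable_int (igx _ mg).
- exists M; split => // x /= nH; apply: NM; apply: contrapT => nN; apply: nH.
  by rewrite in_itv/= => /g_g /(_ nN) H; apply: cvg_EFin => //; exact: nearW.
- exact: igx (locbdd_meas_cst _).
- by apply: aeW => x n; rewrite /= in_itv/= => /gC; rewrite lee_fin.
move=> _ _; rewrite /lebesgue_integral /Rintegral => H.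
apply: fine_cvg; rewrite fineK//.
by apply: integrable_fin_num (igx _ mg); exact: measurable_itv_lebesgue.
Qed.

End Derivative.

(** * Derivatives along sequences *)

Section SequentialCalculus.
Variable R : realType.
Implicit Types (f g w V D : R -> R) (a b c x y l : R).

Lemma cvg_seq_epsP (u : nat -> R) l : u n @[n --> \oo] --> l <->
  forall e, 0 < e -> \forall n \near \oo, `|u n - l| <= e.
Proof.
split=> [/cvgrPdist_le H e /H|H]; first by apply: filterS => n; rewrite distrC.
by apply/cvgrPdist_le => e /H; apply: filterS => n; rewrite distrC.
Qed.

Lemma is_derive_seqP f x l : is_derive x 1 f l <->
  forall u : nat -> R, (forall n, u n != x) -> u n @[n --> \oo] --> x ->
    (f (u n) - f x) / (u n - x) @[n --> \oo] --> l.
Proof.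
split=> [/is_derive_epsP H u ux /cvg_seq_epsP uxl|H].
  apply/cvg_seq_epsP => e /H[d d0 dH].
  have d2 : 0 < d / 2 by lra.
  have := uxl _ d2; apply: filterS => n und.
  have un0 : u n - x != 0 by rewrite subr_eq0.
  have := dH (u n); rewrite (_ : f _ - _ - _ = ((f (u n) - f x) / (u n - x) - l) * (u n - x)).
    by rewrite normrM ler_pM2r ?normr_gt0//; apply; lra.
  by field.
apply/is_derive_epsP => e e0.
have : (f y - f x) / (y - x) @[y --> x^'] --> l.
  by apply/cvgr_dnbhsP => u [? ?]; exact: H.
move/cvgrPdist_le => /(_ _ e0); rewrite near_withinE => /nbhs_ballP[d /= d0 dH].
exists d => // y yd; have [->|yx] := eqVneq y x.
  by rewrite !subrr mulr0 subrr !normr0 mulr0.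
have yx0 : y - x != 0 by rewrite subr_eq0.
have := dH y; rewrite /ball/= distrC => /(_ yd yx) h.
rewrite (_ : f _ - _ - _ = ((f y - f x) / (y - x) - l) * (y - x)); last by field.
by rewrite normrM ler_wpM2r// distrC.
Qed.

Lemma cvg_addr_invS x : x + n.+1%:R^-1 @[n --> \oo] --> x.
Proof.
rewrite -[X in _ --> X]addr0; apply: cvgD; first exact: cvg_cst.
exact: cvg_harmonic.
Qed.

Lemma lint_is_derive D g a b : locbdd_meas g -> a <= b ->
  (forall x, a < x < b -> is_derive x 1 D (g x)) ->
  (forall x, a < x < b -> {for x, continuous g}) ->
  (forall x, a <= x <= b -> {for x, continuous D}) ->
  \lint_(x in `[a, b]) g x = D b - D a.
Proof.
move=> mg ab dD cg cD; rewrite -oriented_integralB//.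
set E := fun y => D y - oriented_integral g y.
suff : E a = E b by rewrite /E; lra.
apply: eq_of_is_derive0 => // x xab.
  have := is_deriveB (dD x xab) (is_derive_oriented_integral mg (cg x xab)).
  by rewrite subrr.
by apply: cvgB; [exact: cD|exact: continuous_oriented_integral].
Qed.

(** The exceptional set rules out the mean value theorem. The difference quotients of
    [V] converge to [w] boundedly, and their integrals over [[a, b]] telescope to
    means of [V] over short intervals at [b] and at [a]. *)
Lemma lint_ae_derivative V w a b (L : R) (N : set R) : locbdd_meas w -> a <= b ->
  (forall x y, `|V y - V x| <= L * `|y - x|) ->
  (@completed_lebesgue_measure R).-negligible N ->
  (forall x, a <= x <= b -> ~ N x -> is_derive x 1 V (w x)) ->
  \lint_(x in `[a, b]) w x = V b - V a.
Proof.
move=> mw ab VL N0 dV.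
have cV : continuous V.
  move=> x; apply/cvgr_ballP => e e0.
  have L1 : 0 < `|L| + 1 by have := normr_ge0 L; lra.
  exists (e / (`|L| + 1)); first by rewrite divr_gt0.
  move=> y; rewrite ltr_pdivlMr// => yc.
  apply: le_trans (VL _ _) (le_trans _ (ltW yc)).
  by rewrite mulrC ler_wpM2l//; have := ler_norm L; lra.
pose s n : R := n.+1%:R^-1.
have s0 n : 0 < s n by rewrite invr_gt0.
have sK x n : x + s n - x = s n by rewrite addrAC subrr add0r.
have mV := locbdd_meas_continuous cV.
have cVs n : continuous (fun x => V (x + s n)).
  move=> x; apply: (@continuous_comp _ _ _ (fun x => x + s n) V); last exact: cV.
  by apply: cvgD; [exact: cvg_id|exact: cvg_cst].
have mVs n := locbdd_meas_continuous (cVs n).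
pose q n x := (s n)^-1 * (V (x + s n) - V x).
have mq n : locbdd_meas (q n) by apply: locbdd_measZ; exact: locbdd_measB.
have lim1 : \lint_(x in `[a, b]) q n x @[n --> \oo] --> \lint_(x in `[a, b]) w x.
  apply: (@lint_dominated R q w a b N L) => //.
    move=> x xab Nx; have /is_derive_seqP := dV x xab Nx.
    move=> /(_ (fun n => x + s n)) H.
    rewrite (_ : (fun n => _) = (fun n => (V (x + s n) - V x) / (x + s n - x))).
      apply: H; last exact: cvg_addr_invS.
      by move=> n; rewrite -subr_eq0 sK gt_eqF.
    by apply/funext => n; rewrite sK mulrC.
  move=> n x _; rewrite /q normrM gtr0_norm ?invr_gt0// mulrC.
  rewrite ler_pdivrMr// (le_trans (VL _ _))// sK gtr0_norm//.
set P := oriented_integral V.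
have dP x : is_derive x 1 P (V x) by apply: is_derive_oriented_integral => //; exact: cV.
have shift n : \lint_(x in `[a, b]) V (x + s n) = P (b + s n) - P (a + s n).
  apply: (@lint_is_derive (fun x => P (x + s n))) => //.
  - move=> x _.
    have d2 : is_derive x 1 (fun z : R => z + s n) 1.
      have := is_deriveD (is_derive_id x (1 : R)) (is_derive_cst (s n) x (1 : R)).
      by rewrite addr0.
    by have := @is_derive1_comp R P (fun z => z + s n) x _ _ (dP (x + s n)) d2; rewrite mulr1.
  - by move=> x _; exact: cVs.
  - move=> x _; apply: (@continuous_comp _ _ _ (fun x => x + s n) P).
      by apply: cvgD; [exact: cvg_id|exact: cvg_cst].
    exact: is_derive_cont.
have lim2 : \lint_(x in `[a, b]) q n x @[n --> \oo] --> V b - V a.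
  rewrite (_ : (fun n => _) = (fun n => (P (b + s n) - P b) / (b + s n - b)
                      - (P (a + s n) - P a) / (a + s n - a))); last first.
    apply/funext => n; rewrite lintZ_segment; last exact: locbdd_measB.
    rewrite lint_subr_segment// shift -(oriented_integralB mV ab) -/P.
    by rewrite !sK /q; field; rewrite gt_eqF.
  have lx x : (P (x + s n) - P x) / (x + s n - x) @[n --> \oo] --> V x.
    have /is_derive_seqP H := dP x; apply: H; last exact: cvg_addr_invS.
    by move=> n; rewrite -subr_eq0 sK gt_eqF.
  by apply: cvgB; exact: lx.
exact: cvg_unique lim1 lim2.
Qed.

Lemma cvg_seq_le_bound (u : nat -> R) l : u n @[n --> \oo] --> l ->
  exists C, forall n, `|u n| <= C.
Proof.
move=> ul; have uc : cvgn u by apply/cvg_ex; exists l.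
have [M _ uM] := pinfty_ex_gt0 (cvg_seq_bounded uc).
by exists M => n; exact: uM.
Qed.

Lemma continuous_seq f x (u : nat -> R) : {for x, continuous f} ->
  u n @[n --> \oo] --> x -> f (u n) @[n --> \oo] --> f x.
Proof. by move=> cf ux; apply: continuous_cvg. Qed.

Lemma continuous_seqP f x : {for x, continuous f} <->
  forall u : nat -> R, u n @[n --> \oo] --> x -> f (u n) @[n --> \oo] --> f x.
Proof.
split=> [cf u|H]; first exact: continuous_seq.
by apply/(@cvg_nbhsP R R^o f x (f x)) => u; exact: H.
Qed.

(** Only finitely many terms of a convergent sequence are far from the limit, so
    limits may be tested on sequences that stay in a given neighbourhood. *)
Lemma seq_near_subst x d (u : nat -> R) : 0 < d -> u n @[n --> \oo] --> x ->
  let v n := if `|u n - x| < d then u n else x + d / 2 in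
  [/\ forall n, `|v n - x| < d, v n @[n --> \oo] --> x &
      \forall n \near \oo, v n = u n].
Proof.
move=> d0 ux v; have vu : \forall n \near \oo, v n = u n.
  have d2 : 0 < d / 2 by lra.
  have /cvg_seq_epsP/(_ _ d2) := ux; apply: filterS => n un.
  by rewrite /v ifT//; lra.
split=> //.
  move=> n; rewrite /v; case: ifP => // _.
  have -> : x + d / 2 - x = d / 2 by ring.
  by rewrite gtr0_norm; lra.
apply: cvg_trans ux; apply: near_eq_cvg.
by apply: filterS vu => n ->.
Qed.

Lemma is_derive_seq_near f x l d : 0 < d ->
  (forall u : nat -> R, (forall n, u n != x /\ `|u n - x| < d) ->
    u n @[n --> \oo] --> x ->
    (f (u n) - f x) / (u n - x) @[n --> \oo] --> l) ->
  is_derive x 1 f l.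
Proof.
move=> d0 H; apply/is_derive_seqP => u ux u_x.
have := seq_near_subst d0 u_x; set v := fun n => _ => -[vd v_x vu].
have vx n : v n != x.
  rewrite /v; case: ifP => // _; rewrite -subr_eq0.
  have -> : x + d / 2 - x = d / 2 by ring.
  by rewrite gt_eqF//; lra.
have := H v (fun n => conj (vx n) (vd n)) v_x.
by apply: cvg_trans; apply: near_eq_cvg; apply: filterS vu => n ->.
Qed.

Lemma continuous_seq_near f x d : 0 < d ->
  (forall u : nat -> R, (forall n, `|u n - x| < d) ->
    u n @[n --> \oo] --> x -> f (u n) @[n --> \oo] --> f x) ->
  {for x, continuous f}.
Proof.
move=> d0 H; apply/continuous_seqP => u u_x.
have := seq_near_subst d0 u_x; set v := fun n => _ => -[vd v_x vu].
have := H v vd v_x.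
by apply: cvg_trans; apply: near_eq_cvg; apply: filterS vu => n ->.
Qed.

Lemma cvg_quotient_squeeze (lo hi D d : nat -> R) l : (forall n, d n != 0) ->
  (forall n, lo n <= D n <= hi n) -> lo n / d n @[n --> \oo] --> l ->
  hi n / d n @[n --> \oo] --> l -> D n / d n @[n --> \oo] --> l.
Proof.
move=> dn0 lDh /cvg_seq_epsP lol /cvg_seq_epsP hil; apply/cvg_seq_epsP => e e0.
apply: filterS2 (lol _ e0) (hil _ e0) => n; have /andP[lD Dh] := lDh n.
rewrite !ler_norml => lo_e hi_e.
have [d0|d0|d0] := ltgtP (d n) 0; last by have := dn0 n; rewrite d0 eqxx.
- have h1 : D n / d n <= lo n / d n by rewrite ler_nM2r ?invr_lt0.
  have h2 : hi n / d n <= D n / d n by rewrite ler_nM2r ?invr_lt0.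
  by lra.
- have h1 : lo n / d n <= D n / d n by rewrite ler_pM2r ?invr_gt0.
  have h2 : D n / d n <= hi n / d n by rewrite ler_pM2r ?invr_gt0.
  by lra.
Qed.

End SequentialCalculus.

(** * The strictly convex superlinear flux *)

Section ConvexFlux.
Variables (R : realType) (f : R -> R).
Hypotheses (f_C2 : C2 f) (f_convex : strictly_convex f).
Implicit Types v w p c : R.

Lemma C2_is_derive v : is_derive v 1 f (derive1 f v).
Proof. by case: f_C2 => df _ _; rewrite derive1E; exact: derivableP. Qed.

Lemma C2_continuous : continuous f.
Proof. by move=> v; exact: is_derive_cont (C2_is_derive v). Qed.

Lemma C2_derive1_continuous : continuous (derive1 f).
Proof.
by case: f_C2 => _ d2f _ v; apply/differentiable_continuous/derivable1_diffP.
Qed.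

(** A violation with gap [g] would be inherited, by convexity, by the points
    [s w + (1 - s) v] with gap [s g], against differentiability at [v] as [s -> 0]. *)
Lemma tangent_le v w : f v + derive1 f v * (w - v) <= f w.
Proof.
set l := derive1 f v; rewrite leNgt; apply/negP => H.
have wv : w != v.
  by apply: contraTneq H => ->; rewrite subrr mulr0 addr0 ltxx.
have n0 : 0 < `|w - v| by rewrite normr_gt0 subr_eq0.
set g := f v + l * (w - v) - f w.
have g0 : 0 < g by rewrite subr_gt0.
(* half the slope of the gap *)
have e0 : 0 < g / (2 * `|w - v|) by rewrite divr_gt0// mulr_gt0.
have /is_derive_epsP/(_ _ e0)[d d0 dH] := C2_is_derive v.
set s := Num.min (1 / 2) (d / (2 * `|w - v|)).
have s0 : 0 < s by rewrite lt_min; apply/andP; split; [lra|rewrite divr_gt0// mulr_gt0].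
have s12 : s <= 1 / 2 by rewrite /s ge_min lexx.
have sd : s * `|w - v| <= d / 2.
  have : s <= d / (2 * `|w - v|) by rewrite /s ge_min lexx orbT.
  rewrite -(ler_pM2r n0) => h; apply: le_trans h _.
  by rewrite le_eqVlt; apply/orP; left; apply/eqP; field; rewrite gt_eqF.
set y := s * w + (1 - s) * v.
have yv : y - v = s * (w - v) by rewrite /y; ring.
have cvx : f y < s * f w + (1 - s) * f v by apply: f_convex => //; lra.
have := dH y; rewrite yv normrM (gtr0_norm s0) => h.
have {}h := h (le_lt_trans sd _).
have sg : g / (2 * `|w - v|) * (s * `|w - v|) = s * g / 2.
  by field; rewrite gt_eqF.
move: h; rewrite sg -/l => /(_ ltac:(lra)); rewrite ler_norml => /andP[h _].
have E : s * f w + (1 - s) * f v = f v + s * (l * (w - v)) - s * g by rewrite /g; ring.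
have E2 : l * (s * (w - v)) = s * (l * (w - v)) by ring.
have sg0 : 0 < s * g by rewrite mulr_gt0.
move: cvx h; rewrite E E2; lra.
Qed.

(** Strict convexity at the midpoint, combined with the tangent inequality there. *)
Lemma tangent_lt v w : v != w -> f v + derive1 f v * (w - v) < f w.
Proof.
move=> vw; have := tangent_le v (1 / 2 * v + (1 - 1 / 2) * w).
have : f (1 / 2 * v + (1 - 1 / 2) * w) < 1 / 2 * f v + (1 - 1 / 2) * f w.
  by apply: f_convex => //; lra.
have -> : 1 / 2 * v + (1 - 1 / 2) * w - v = (w - v) / 2 by field.
set m := f _; set l := derive1 f v.
have -> : l * ((w - v) / 2) = l * (w - v) / 2 by rewrite mulrA.
lra.
Qed.

Lemma derive1_strict_mono v w : v < w -> derive1 f v < derive1 f w.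
Proof.
move=> vw; have vw' : v != w by rewrite lt_eqF.
have h1 := tangent_lt vw'; have h2 := tangent_lt (negbT (gt_eqF vw)).
have wv0 : 0 < w - v by rewrite subr_gt0.
rewrite -(ltr_pM2r wv0).
by have : derive1 f w * (v - w) = - (derive1 f w * (w - v)); [ring|lra].
Qed.

(** The supremum is attained at [v] by the tangent inequality. *)
Lemma legendre_derive1 v : legendre f (derive1 f v) = v * derive1 f v - f v.
Proof.
set m := _ - _; have ubm : ubound (range (fun w => derive1 f v * w - f w)) m.
  move=> _ [w _ <-]; rewrite /m.
  have := tangent_le v w; rewrite mulrBr [v * _]mulrC; lra.
apply/eqP; rewrite eq_le; apply/andP; split.
  by apply: ge_sup => //; exists (derive1 f v * 0 - f 0), 0.
apply: ub_le_sup; first by exists m.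
by exists v => //; rewrite /m mulrC.
Qed.

Hypothesis f_superlinear : superlinear f.

(** The tangent at [w] evaluated at [0] gives [f' w >= (f w - f 0) / w]. *)
Lemma derive1_unbounded_above c : exists v, forall w, v <= w -> c <= derive1 f w.
Proof.
have [/cvgryPge/(_ (c + `|f 0|)) [v [_ vH]] _] := f_superlinear.
exists (Num.max (v + 1) 1) => w; rewrite ge_max => /andP[vw w1].
have w0 : 0 < w by lra.
have := vH w ltac:(lra); rewrite (gtr0_norm w0) ler_pdivlMr// mulrDl => h.
have := tangent_le w 0; rewrite sub0r mulrN => h2.
have h3 : f 0 <= `|f 0| * w.
  by apply: le_trans (ler_norm _) _; rewrite ler_peMr.
by rewrite -(ler_pM2r w0); lra.
Qed.

Lemma derive1_unbounded_below c : exists v, forall w, w <= v -> derive1 f w <= c.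
Proof.
have [_ /cvgryPge/(_ (- c + `|f 0|)) [v [_ vH]]] := f_superlinear.
exists (Num.min (v - 1) (- 1)) => w; rewrite le_min => /andP[vw w1].
have w0 : w < 0 by lra.
have nw0 : 0 < - w by lra.
have := vH w ltac:(lra); rewrite (ltr0_norm w0) ler_pdivlMr// mulrDl => h.
have := tangent_le w 0; rewrite sub0r => h2.
have h3 : f 0 <= `|f 0| * (- w).
  by apply: le_trans (ler_norm _) _; rewrite ler_peMr//; lra.
by rewrite -(ler_pM2r nw0); lra.
Qed.

End ConvexFlux.

(** * Primitives depending on a parameter *)

Section ParametricIntegral.
Variable R : realType.
Implicit Types (phi : R -> R -> R) (g : R -> R) (q s t x y : R).

Lemma norm_le_sum x y r : `|x - y| <= r -> `|x| <= `|y| + r.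
Proof.
by move=> h; rewrite -[x](subrK y) (le_trans (ler_normD _ _))// addrC lerD2l.
Qed.

Lemma oriented_integral_mean g s t : continuous g -> exists2 xi,
  `|xi - t| <= `|s - t| &
  oriented_integral g s - oriented_integral g t = g xi * (s - t).
Proof.
move=> cg; have mg := locbdd_meas_continuous cg.
have dI x : is_derive x 1 (oriented_integral g) (g x).
  by apply: is_derive_oriented_integral => //; exact: cg.
have cI := continuous_oriented_integral mg.
have mvt a b : a <= b -> exists2 xi, a <= xi <= b &
    oriented_integral g b - oriented_integral g a = g xi * (b - a).
  move=> ab; have [xi] := MVT_segment ab (fun x _ => dI x) (continuous_subspaceT cI).
  by rewrite in_itv/= => abxi E; exists xi.
have [ts|st] := leP t s.
  by have [xi txi ->] := mvt _ _ ts; exists xi => //; rewrite !ger0_norm; lra.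
have [xi txi E] := mvt _ _ (ltW st); exists xi; first by rewrite !ler0_norm; lra.
by rewrite -opprB E -mulrN opprB.
Qed.

Lemma oriented_integral_dominated (g_ : nat -> R -> R) g x :
  (forall n, locbdd_meas (g_ n)) -> locbdd_meas g ->
  (forall y, g_ n y @[n --> \oo] --> g y) ->
  (exists C, forall n y, `|y| <= `|x| -> `|g_ n y| <= C) ->
  oriented_integral (g_ n) x @[n --> \oo] --> oriented_integral g x.
Proof.
move=> mg_ mg g_g [C gC]; rewrite /oriented_integral.
have [x0|x0] := leP 0 x.
  apply: (@lint_dominated _ _ _ _ _ set0 C) => //.
    exact: negligible_set0.
  by move=> n y yx; apply: gC; rewrite !ger0_norm; lra.
apply: cvgN; apply: (@lint_dominated _ _ _ _ _ set0 C) => //.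
  exact: negligible_set0.
by move=> n y yx; apply: gC; rewrite !ler0_norm; lra.
Qed.

(** Joint continuity, in the form in which limits of parameters and times are taken. *)
Definition seq_continuous2 phi := forall (q_ t_ : nat -> R) q t,
  q_ n @[n --> \oo] --> q -> t_ n @[n --> \oo] --> t ->
  phi (q_ n) (t_ n) @[n --> \oo] --> phi q t.

Definition bounded2 phi := forall Q T : R, exists C : R,
  forall q t, `|q| <= Q -> `|t| <= T -> `|phi q t| <= C.

Lemma seq_continuous2_snd phi q : seq_continuous2 phi -> continuous (phi q).
Proof.
by move=> cphi t; apply/continuous_seqP => u; apply: cphi; exact: cvg_cst.
Qed.

Lemma seq_continuous2_fst phi t : seq_continuous2 phi ->
  continuous (fun q => phi q t).
Proof.
by move=> cphi q; apply/continuous_seqP => u /cphi; apply; exact: cvg_cst.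
Qed.

(** Dominated convergence in the parameter; the endpoint costs at most a constant
    times its displacement, uniformly in the parameter. *)
Lemma seq_continuous2_oriented_integral phi : seq_continuous2 phi ->
  bounded2 phi -> seq_continuous2 (fun q t => oriented_integral (phi q) t).
Proof.
move=> cphi bphi q_ t_ q t q_q t_t.
have mphi p : locbdd_meas (phi p).
  by apply: locbdd_meas_continuous; exact: seq_continuous2_snd.
have [Q qQ] := cvg_seq_le_bound q_q; have [T tT] := cvg_seq_le_bound t_t.
have [C phiC] := bphi Q (`|t| + (T + `|t|)).
have h1 : oriented_integral (phi (q_ n)) t @[n --> \oo] --> oriented_integral (phi q) t.
  apply: oriented_integral_dominated => //.
    by move=> y; apply: cphi => //; exact: cvg_cst.
  exists C => n y yt; apply: phiC => //; have := normr_ge0 t.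
  have := le_trans (normr_ge0 _) (tT 0%N); lra.
apply/cvg_seq_epsP => e e0; have e2 : 0 < e / 2 by lra.
have C1 : 0 < `|C| + 1 by have := normr_ge0 C; lra.
have /cvg_seq_epsP/(_ _ e2) := h1.
have /cvg_seq_epsP/(_ _ (divr_gt0 e2 C1)) := t_t.
apply: filterS2 => n; rewrite ler_pdivlMr// => tn qn.
rewrite -[_ - _](subrKA (oriented_integral (phi (q_ n)) t)).
apply: le_trans (ler_normD _ _) _; rewrite [leRHS]splitr lerD//.
apply: le_trans (_ : C * `|t_ n - t| <= _).
  apply: norm_oriented_integralB_le => // z zt; apply: phiC => //.
  apply: norm_le_sum; apply: le_trans zt _.
  by rewrite (le_trans (ler_normB _ _))// lerD2r.
by apply: le_trans tn; rewrite mulrC ler_wpM2l//; have := ler_norm C; lra.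
Qed.

(** By the mean value theorem the quotient is a value of [phi (q_ n)] between [t] and
    [t_ n]. *)
Lemma cvg_oriented_integral_quotient phi (q_ t_ : nat -> R) q t :
  seq_continuous2 phi -> (forall n, t_ n != t) ->
  q_ n @[n --> \oo] --> q -> t_ n @[n --> \oo] --> t ->
  (oriented_integral (phi (q_ n)) (t_ n) - oriented_integral (phi (q_ n)) t)
    / (t_ n - t) @[n --> \oo] --> phi q t.
Proof.
move=> cphi tnt q_q t_t.
have /choice[xi xiP] : forall n, exists xi, `|xi - t| <= `|t_ n - t| /\
    oriented_integral (phi (q_ n)) (t_ n) - oriented_integral (phi (q_ n)) t
    = phi (q_ n) xi * (t_ n - t).
  move=> n; have [xi ? ?] := @oriented_integral_mean (phi (q_ n)) (t_ n) t
    (seq_continuous2_snd cphi).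
  by exists xi.
rewrite (_ : (fun n => _) = (fun n => phi (q_ n) (xi n))).
  apply: cphi => //; apply/cvg_seq_epsP => e e0.
  have /cvg_seq_epsP/(_ _ e0) := t_t; apply: filterS => n.
  by apply: le_trans; exact: (xiP n).1.
by apply/funext => n; rewrite (xiP n).2 mulfK// subr_eq0.
Qed.

End ParametricIntegral.

(** * The action as a Legendre transform *)

Section Action.
Variables (R : realType) (f beta : R -> R).
Hypotheses (f_C2 : C2 f) (f_convex : strictly_convex f)
  (f_superlinear : superlinear f) (beta_continuous : continuous beta).
Implicit Types (q p t z : R).

Definition energy_density q t := f (q * expR (beta t)) * expR (- beta t).
Definition speed q t := derive1 f (q * expR (beta t)).
(** The convex function [K] of the introduction; [displacement] is its slope [G] and
    [momentum] the inverse [h] of that slope. They are locked so that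
    two of them are compared through their arguments, not through integrals. *)
Definition energy := locked (fun q t => oriented_integral (energy_density q) t).
Definition displacement := locked (fun q t => oriented_integral (speed q) t).
Definition momentum := locked (fun z t => hfun f beta z t).
Definition action z t := momentum z t * z - energy (momentum z t) t.

Lemma energyE q t : energy q t = oriented_integral (energy_density q) t.
Proof. by rewrite /energy -lock. Qed.

Lemma displacementE q t : displacement q t = oriented_integral (speed q) t.
Proof. by rewrite /displacement -lock. Qed.

Lemma momentumE z t : momentum z t = hfun f beta z t.
Proof. by rewrite /momentum -lock. Qed.

Lemma continuous_expR_beta : continuous (fun t => expR (beta t)).
Proof.
by move=> t; apply: continuous_comp; [exact: beta_continuous|exact: continuous_expR].
Qed.

Lemma continuous_expRN_beta : continuous (fun t => expR (- beta t)).
Proof.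
move=> t; apply: (@continuous_comp _ _ _ (fun t => - beta t) expR).
  by apply: cvgN; exact: beta_continuous.
exact: continuous_expR.
Qed.

Lemma seq_continuous2_rescaled (F : R -> R) : continuous F ->
  seq_continuous2 (fun q t => F (q * expR (beta t))).
Proof.
move=> cF q_ t_ q t q_q t_t; apply: continuous_seq; first exact: cF.
have e_e : expR (beta (t_ n)) @[n --> \oo] --> expR (beta t).
  exact: continuous_seq (@continuous_expR_beta t) t_t.
exact: cvgM q_q e_e.
Qed.

Lemma bounded2_rescaled (F : R -> R) : continuous F ->
  bounded2 (fun q t => F (q * expR (beta t))).
Proof.
move=> cF Q T; have [E EP] := continuous_locbdd continuous_expR_beta T.
have [C CP] := continuous_locbdd cF (Q * E).
by exists C => q t qQ tT; apply: CP; rewrite normrM ler_pM// EP.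
Qed.

Lemma seq_continuous2_speed : seq_continuous2 speed.
Proof. by apply: seq_continuous2_rescaled; exact: C2_derive1_continuous. Qed.

Lemma bounded2_speed : bounded2 speed.
Proof. by apply: bounded2_rescaled; exact: C2_derive1_continuous. Qed.

Lemma seq_continuous2_energy_density : seq_continuous2 energy_density.
Proof.
move=> q_ t_ q t q_q t_t.
have e_e : expR (- beta (t_ n)) @[n --> \oo] --> expR (- beta t).
  exact: continuous_seq (@continuous_expRN_beta t) t_t.
exact: cvgM (seq_continuous2_rescaled (C2_continuous f_C2) q_q t_t) e_e.
Qed.

Lemma bounded2_energy_density : bounded2 energy_density.
Proof.
move=> Q T; have [E EP] := continuous_locbdd continuous_expRN_beta T.
have [C CP] := bounded2_rescaled (C2_continuous f_C2) Q T.
by exists (C * E) => q t qQ tT; rewrite normrM ler_pM// (CP, EP).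
Qed.

Lemma seq_continuous2_energy : seq_continuous2 energy.
Proof.
rewrite /energy -lock.
apply: seq_continuous2_oriented_integral.
  exact: seq_continuous2_energy_density.
exact: bounded2_energy_density.
Qed.

Lemma seq_continuous2_displacement : seq_continuous2 displacement.
Proof.
rewrite /displacement -lock.
exact: seq_continuous2_oriented_integral seq_continuous2_speed bounded2_speed.
Qed.

Lemma locbdd_meas_speed q : locbdd_meas (speed q).
Proof.
by apply: locbdd_meas_continuous; exact: seq_continuous2_snd seq_continuous2_speed.
Qed.

Lemma locbdd_meas_energy_density q : locbdd_meas (energy_density q).
Proof.
by apply: locbdd_meas_continuous; exact: seq_continuous2_snd seq_continuous2_energy_density.
Qed.

Lemma displacement_strict_mono t p q : 0 < t -> p < q ->
  displacement p t < displacement q t.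
Proof.
move=> t0 pq; rewrite -subr_gt0 !displacementE -oriented_integral_subr;
  do ?exact: locbdd_meas_speed.
have cs : continuous (fun s => speed q s - speed p s).
  by move=> s; apply: cvgB; exact: seq_continuous2_snd seq_continuous2_speed s.
have [xi _] := oriented_integral_mean t 0 cs.
rewrite oriented_integral0 ?subr0; last exact: locbdd_meas_continuous.
move=> ->; rewrite mulr_gt0// subr_gt0; apply: derive1_strict_mono => //.
by rewrite ltr_pM2r ?expR_gt0.
Qed.

Lemma displacement_mono t p q : 0 < t -> p <= q ->
  displacement p t <= displacement q t.
Proof.
by move=> t0; rewrite le_eqVlt => /predU1P[->//|/(displacement_strict_mono t0)/ltW].
Qed.

Lemma displacement_ltE t p q : 0 < t ->
  (displacement p t < displacement q t) = (p < q).
Proof.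
move=> t0; apply/idP/idP => [|]; last exact: displacement_strict_mono.
by apply: contraTT; rewrite -!leNgt; exact: displacement_mono.
Qed.

(** The tangent inequality of [f] at [q e^beta], multiplied by [e^-beta] and integrated. *)
Lemma energy_tangent t p q : 0 <= t ->
  energy q t + displacement q t * (p - q) <= energy p t.
Proof.
move=> t0; rewrite mulrC !energyE displacementE.
have mE := locbdd_meas_energy_density; have mS := locbdd_meas_speed.
rewrite -oriented_integralZ// -oriented_integralD//; last exact: locbdd_measZ.
rewrite /oriented_integral t0; apply: le_lint_segment => //.
  by apply: locbdd_measD => //; exact: locbdd_measZ.
move=> s _; rewrite /energy_density /speed.
have e0 := expR_gt0 (beta s).
have ee : expR (beta s) * expR (- beta s) = 1 by rewrite -expRD subrr expR0.
have := tangent_le f_C2 f_convex (q * expR (beta s)) (p * expR (beta s)).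
rewrite -(ler_pM2r (expR_gt0 (- beta s))) mulrDl; apply: le_trans.
rewrite lerD2l -mulrBl !mulrA -[leRHS]mulrA ee mulr1 mulrC//.
Qed.

(** [e^beta] lies between two positive constants on [[0, t]], so [f' (q e^beta)]
    exceeds any bound on the whole segment for [q] large; then the intermediate value
    theorem applies. *)
Lemma displacement_surj z t : 0 < t -> exists q, displacement q t = z.
Proof.
move=> t0; have t0' := ltW t0.
have [B betaB] := continuous_locbdd beta_continuous t.
have eB s : 0 <= s <= t -> 1 <= expR B * expR (beta s).
  move=> st; rewrite -expRD -[leLHS]expR0 ler_expR.
  have : `|s| <= t by rewrite ger0_norm; lra.
  by move/betaB; rewrite ler_norml; lra.
have [v vP] := derive1_unbounded_above f_C2 f_convex f_superlinear (z / t).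
have [w wP] := derive1_unbounded_below f_C2 f_convex f_superlinear (z / t).
have zE : z = z / t * (t - 0) by rewrite subr0 divfK// gt_eqF.
have oE q : displacement q t = \lint_(s in `[0, t]) speed q s.
  by rewrite displacementE /oriented_integral ltW.
have hi : z <= displacement (Num.max v 0 * expR B) t.
  rewrite oE [leLHS]zE -lint_cst_segment//.
  apply: le_lint_segment => //; [exact: locbdd_meas_cst|exact: locbdd_meas_speed|].
  move=> s /eB se; apply: vP; rewrite -mulrA.
  apply: le_trans (_ : Num.max v 0 <= _); first by rewrite le_max lexx.
  by rewrite ler_peMr// le_max lexx orbT.
have lo : displacement (Num.min w 0 * expR B) t <= z.
  rewrite oE [leRHS]zE -lint_cst_segment//.
  apply: le_lint_segment => //; [exact: locbdd_meas_speed|exact: locbdd_meas_cst|].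
  move=> s /eB se; apply: wP; rewrite -mulrA.
  apply: le_trans (_ : Num.min w 0 <= _); last by rewrite ge_min lexx.
  by rewrite ler_neMr// ge_min lexx orbT.
have ab : Num.min w 0 * expR B <= Num.max v 0 * expR B.
  rewrite ler_pM2r ?expR_gt0//; apply: (@le_trans _ _ 0).
    by rewrite ge_min lexx orbT.
  by rewrite le_max lexx orbT.
have cd : {within `[Num.min w 0 * expR B, Num.max v 0 * expR B],
    continuous (fun q => displacement q t)}.
  by apply: continuous_subspaceT; exact: seq_continuous2_fst seq_continuous2_displacement.
suff /(IVT ab cd)[q _ qz] : Num.min (displacement (Num.min w 0 * expR B) t)
    (displacement (Num.max v 0 * expR B) t) <= z <=
  Num.max (displacement (Num.min w 0 * expR B) t)
    (displacement (Num.max v 0 * expR B) t) by exists q.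
apply/andP; split; first by rewrite ge_min; apply/orP; left; exact: lo.
by rewrite le_max; apply/orP; right; exact: hi.
Qed.

Lemma displacement_momentum z t : 0 < t -> displacement (momentum z t) t = z.
Proof.
move=> t0; have [q qz] := displacement_surj z t0.
have E p : displacement p t = \lint_(th in `[0, t]) derive1 f (p * expR (beta th)).
  by rewrite displacementE /oriented_integral ltW.
have : [set p | \lint_(th in `[0, t]) derive1 f (p * expR (beta th)) = z]
    (momentum z t) by rewrite momentumE; apply: getPex; exists q; rewrite /= -E.
by rewrite /= -E.
Qed.

Lemma momentum_lt z q t : 0 < t -> (momentum z t < q) = (z < displacement q t).
Proof. by move=> t0; rewrite -(displacement_ltE _ _ t0) displacement_momentum. Qed.

Lemma momentum_gt z q t : 0 < t -> (q < momentum z t) = (displacement q t < z).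
Proof. by move=> t0; rewrite -(displacement_ltE _ _ t0) displacement_momentum. Qed.

Lemma momentum_le z q t : 0 < t -> (momentum z t <= q) = (z <= displacement q t).
Proof. by move=> t0; rewrite !leNgt momentum_gt. Qed.

Lemma momentum_ge z q t : 0 < t -> (q <= momentum z t) = (displacement q t <= z).
Proof. by move=> t0; rewrite !leNgt momentum_lt. Qed.

Lemma momentum_strict_mono z z' t : 0 < t -> z < z' -> momentum z t < momentum z' t.
Proof. by move=> t0 zz'; rewrite momentum_lt// displacement_momentum. Qed.

Lemma momentum_mono z z' t : 0 < t -> z <= z' -> momentum z t <= momentum z' t.
Proof. by move=> t0 zz'; rewrite momentum_le// displacement_momentum. Qed.

(** Monotonicity in [q] reduces joint continuity of the inverse to the continuity in
    time of [displacement (q + e)] and [displacement (q - e)]. *)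
Lemma cvg_momentum (z_ t_ : nat -> R) z t : 0 < t ->
  z_ n @[n --> \oo] --> z -> t_ n @[n --> \oo] --> t ->
  momentum (z_ n) (t_ n) @[n --> \oo] --> momentum z t.
Proof.
move=> t0 z_z t_t; apply/cvg_seq_epsP => e e0; set q := momentum z t.
have hi : 0 < displacement (q + e) t - z by rewrite subr_gt0 -momentum_lt// -/q; lra.
have lo : 0 < z - displacement (q - e) t by rewrite subr_gt0 -momentum_gt// -/q; lra.
have d p : displacement p (t_ n) @[n --> \oo] --> displacement p t.
  by apply: seq_continuous2_displacement => //; exact: cvg_cst.
have near_le (u : nat -> R) l r : u n @[n --> \oo] --> l -> 0 < r ->
    \forall n \near \oo, `|u n - l| <= r by move/cvg_seq_epsP; exact.
have t2 : 0 < t / 2 by lra.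
have hi3 : 0 < (displacement (q + e) t - z) / 3 by lra.
have lo3 : 0 < (z - displacement (q - e) t) / 3 by lra.
have Ht := near_le _ _ _ t_t t2.
have H1 := near_le _ _ _ (d (q + e)) hi3.
have H2 := near_le _ _ _ (d (q - e)) lo3.
have H3 := near_le _ _ _ z_z hi3.
have H4 := near_le _ _ _ z_z lo3.
near=> n.
have tn : `|t_ n - t| <= t / 2 by near: n; exact: Ht.
have h1 : `|displacement (q + e) (t_ n) - displacement (q + e) t| <=
  (displacement (q + e) t - z) / 3 by near: n; exact: H1.
have h2 : `|displacement (q - e) (t_ n) - displacement (q - e) t| <=
  (z - displacement (q - e) t) / 3 by near: n; exact: H2.
have h3 : `|z_ n - z| <= (displacement (q + e) t - z) / 3 by near: n; exact: H3.
have h4 : `|z_ n - z| <= (z - displacement (q - e) t) / 3 by near: n; exact: H4.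
move: tn h1 h2 h3 h4; rewrite !ler_norml => tn h1 h2 h3 h4.
have tn0 : 0 < t_ n by lra.
have a1 : momentum (z_ n) (t_ n) <= q + e by rewrite momentum_le//; lra.
have a2 : q - e <= momentum (z_ n) (t_ n) by rewrite momentum_ge//; lra.
by lra.
Unshelve. all: by end_near. Qed.

(** The tangent inequality of the energy at the momentum of [z]; equality holds for
    [q = momentum z t]. *)
Lemma action_ge q z t : 0 < t -> q * z - energy q t <= action z t.
Proof.
move=> t0; rewrite /action.
have := energy_tangent q (momentum z t) (ltW t0).
by rewrite displacement_momentum// mulrBr [z * q]mulrC [z * _]mulrC; lra.
Qed.

Lemma action_subgradient z z' t : 0 < t ->
  momentum z t * (z' - z) <= action z' t - action z t.
Proof.
by move=> t0; have := action_ge (momentum z t) z' t0; rewrite /action; lra.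
Qed.

(** The maximiser at time [t'] is a competitor at time [t]. *)
Lemma action_increment_le z t t' : 0 < t -> 0 < t' ->
  action z t' - action z t <=
  - (energy (momentum z t') t' - energy (momentum z t') t).
Proof.
by move=> t0 t'0; have := action_ge (momentum z t') z t0; rewrite /action; lra.
Qed.

(** The maximiser at time [t] is a competitor at time [t']. *)
Lemma action_increment_ge z t t' : 0 < t -> 0 < t' ->
  - (energy (momentum z t) t' - energy (momentum z t) t) <=
  action z t' - action z t.
Proof.
by move=> t0 t'0; have := action_ge (momentum z t) z t'0; rewrite /action; lra.
Qed.

Lemma cvg_action (z_ t_ : nat -> R) z t : 0 < t ->
  z_ n @[n --> \oo] --> z -> t_ n @[n --> \oo] --> t ->
  action (z_ n) (t_ n) @[n --> \oo] --> action z t.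
Proof.
move=> t0 z_z t_t; have h := cvg_momentum t0 z_z t_t.
apply: cvgB; first exact: cvgM.
exact: seq_continuous2_energy.
Qed.

Lemma Ffun_action u0 x y t : 0 < t ->
  Ffun f beta u0 x y t = action (x - y) t + oriented_integral u0 y.
Proof.
move=> t0; rewrite /Ffun; congr (_ + _).
rewrite -momentumE; set q := momentum (x - y) t.
transitivity (\lint_(th in `[0, t]) (q * speed q th - energy_density q th)).
  apply: eq_Rintegral => s _; rewrite legendre_derive1// /speed /energy_density.
  have ee : expR (beta s) * expR (- beta s) = 1 by rewrite -expRD subrr expR0.
  by rewrite mulrBl; congr (_ - _); rewrite mulrAC -[q * _ * _]mulrA ee mulr1.
have mS := locbdd_meas_speed q; have mE := locbdd_meas_energy_density q.
rewrite lint_subr_segment//; last exact: locbdd_measZ.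
rewrite lintZ_segment//.
have E g : \lint_(s in `[0, t]) g s = oriented_integral g t.
  by rewrite /oriented_integral ltW.
by rewrite !E -displacementE -energyE displacement_momentum.
Qed.

End Action.

(** * Minimisers of the cost and the value function *)

Section Minimizers.
Variables (R : realType) (f beta u0 : R -> R) (M : R).
Hypotheses (f_C2 : C2 f) (f_convex : strictly_convex f)
  (f_superlinear : superlinear f) (beta_continuous : continuous beta)
  (u0_measurable : lebesgue_measurable_fun setT u0)
  (u0_bounded : forall x, `|u0 x| <= M).
Implicit Types (q p t x y z : R).

Notation energy_density := (energy_density f beta).
Notation energy := (energy f beta).
Notation displacement := (displacement f beta).
Notation momentum := (momentum f beta).
Notation action := (action f beta).

(** Locked for the same reason as [energy]. *)
Definition potential := locked (oriented_integral u0).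
Definition cost x t y := action (x - y) t + potential y.
Definition largest_minimizer := locked (fun x t => ystar f beta u0 x t).
Definition value x t := cost x t (largest_minimizer x t).
Definition optimal_momentum x t := momentum (x - largest_minimizer x t) t.

Lemma potentialE y : potential y = oriented_integral u0 y.
Proof. by rewrite /potential -lock. Qed.

Lemma largest_minimizerE x t : largest_minimizer x t = ystar f beta u0 x t.
Proof. by rewrite /largest_minimizer -lock. Qed.

Lemma costE x t y : 0 < t -> Ffun f beta u0 x y t = cost x t y.
Proof. by move=> t0; rewrite Ffun_action// -potentialE. Qed.

Lemma bound_ge0 : 0 <= M.
Proof. exact: le_trans (normr_ge0 _) (u0_bounded 0). Qed.

Lemma locbdd_meas_u0 : locbdd_meas u0.
Proof. by split => // r; exists M => x _. Qed.

Lemma potential_lipschitz x y : `|potential y - potential x| <= M * `|y - x|.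
Proof.
rewrite !potentialE.
by apply: norm_oriented_integralB_le => //; exact: locbdd_meas_u0.
Qed.

Lemma continuous_potential : continuous potential.
Proof.
rewrite /potential -lock.
by apply: continuous_oriented_integral; exact: locbdd_meas_u0.
Qed.

Lemma cvg_cost (x_ t_ y_ : nat -> R) x t y : 0 < t -> x_ n @[n --> \oo] --> x ->
  t_ n @[n --> \oo] --> t -> y_ n @[n --> \oo] --> y ->
  cost (x_ n) (t_ n) (y_ n) @[n --> \oo] --> cost x t y.
Proof.
move=> t0 x_x t_t y_y; apply: cvgD.
  by apply: cvg_action => //; exact: cvgB.
by apply: (continuous_seq _ y_y); exact: continuous_potential.
Qed.

Lemma continuous_cost x t : 0 < t -> continuous (cost x t).
Proof.
move=> t0 y; apply/continuous_seqP => u uy.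
by apply: cvg_cost => //; exact: cvg_cst.
Qed.

(** The action lies above lines of slopes [M + 1] and [- (M + 1)], while the potential
    has Lipschitz constant [M]; hence the cost is coercive. *)
Lemma minimizer_exists x t : 0 < t -> exists y, is_minimizer (cost x t) y.
Proof.
move=> t0; have M0 := bound_ge0.
set E := Num.max (energy (M + 1) t) (energy (- (M + 1)) t).
have E1 : energy (M + 1) t <= E by rewrite /E le_max lexx.
have E2 : energy (- (M + 1)) t <= E by rewrite /E le_max lexx orbT.
have lb y : `|x - y| - E + potential x <= cost x t y.
  have := potential_lipschitz x y; rewrite distrC ler_norml => /andP[_ h].
  rewrite [`|y - x|]distrC in h.
  have h1 := action_ge f_C2 f_convex f_superlinear beta_continuous (M + 1) (x - y) t0.
  have h2 := action_ge f_C2 f_convex f_superlinear beta_continuous (- (M + 1)) (x - y) t0.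
  rewrite /cost; have [z0|z0] := leP 0 (x - y).
    by rewrite (ger0_norm z0) in h *; lra.
  by rewrite (ltr0_norm z0) in h *; lra.
set C := `|E + action 0 t|.
have ab : x - C <= x + C by have := normr_ge0 (E + action 0 t); rewrite -/C; lra.
have cc : {within `[x - C, x + C], continuous (cost x t)}.
  by apply: continuous_subspaceT; exact: continuous_cost.
have [y _ ymin] := EVT_min ab cc; exists y => z.
have [zC|zC] := leP `|x - z| C.
  by apply: ymin; rewrite in_itv/=; move: zC; rewrite ler_norml; lra.
apply: le_trans (ymin x _) _.
  by rewrite in_itv/=; have := normr_ge0 (E + action 0 t); rewrite -/C; lra.
apply: le_trans (lb z); rewrite /cost subrr.
have := ler_norm (E + action 0 t); rewrite -/C; lra.
Qed.

(** The slope of the action at [x - y] is the momentum; where it exceeds the Lipschitz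
    constant of the potential, moving [y] decreases the cost. *)
Lemma minimizer_momentum x t y : 0 < t -> is_minimizer (cost x t) y ->
  - M <= momentum (x - y) t <= M.
Proof.
move=> t0 ymin.
have cmp d : action (x - y) t - action (x - y - d) t <= M * `|d|.
  have := ymin (y + d); rewrite /cost opprD addrA.
  have := potential_lipschitz y (y + d); rewrite (_ : y + d - y = d); last by ring.
  by rewrite ler_norml => /andP[_]; lra.
rewrite momentum_le// momentum_ge//; apply/andP; split; rewrite leNgt; apply/negP => H.
- set D := displacement (- M) t in H.
  have [d dE] : exists d, d = (D - (x - y)) / 2 by eexists.
  have d0 : 0 < d by lra.
  have := cmp (- d); rewrite opprK normrN gtr0_norm// => h.
  have := action_subgradient f_C2 f_convex f_superlinear beta_continuous
    (x - y + d) (x - y) t0.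
  have -> : x - y - (x - y + d) = - d by ring.
  have : momentum (x - y + d) t < - M by rewrite momentum_lt// -/D; lra.
  set m := momentum _ _ => mM; rewrite mulrN => h2.
  have : M * d < - m * d by rewrite ltr_pM2r//; lra.
  by rewrite mulNr; lra.
- set D := displacement M t in H.
  have [d dE] : exists d, d = (x - y - D) / 2 by eexists.
  have d0 : 0 < d by lra.
  have := cmp d; rewrite gtr0_norm// => h.
  have := action_subgradient f_C2 f_convex f_superlinear beta_continuous
    (x - y - d) (x - y) t0.
  have -> : x - y - (x - y - d) = d by ring.
  have : M < momentum (x - y - d) t by rewrite momentum_gt// -/D; lra.
  set m := momentum _ _ => mM h2.
  have : M * d < m * d by rewrite ltr_pM2r.
  by lra.
Qed.

Lemma minimizer_bounds x t y : 0 < t -> is_minimizer (cost x t) y ->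
  displacement (- M) t <= x - y <= displacement M t.
Proof.
move=> t0 /(minimizer_momentum t0).
by rewrite momentum_le// momentum_ge.
Qed.

(** Strict convexity: of two intervals of the same length, the action increases more
    over the one further to the right. *)
Lemma action_four_points a b d t : 0 < t -> a < b -> 0 < d ->
  action (a + d) t + action b t < action (b + d) t + action a t.
Proof.
move=> t0 ab d0.
wlog bad : a b d ab d0 / b <= a + d => [wl|].
  have [|adb] := leP b (a + d); first exact: wl.
  (* b and a + d play symmetric roles *)
  have := wl a (a + d) (b - a); have -> : a + (b - a) = b by ring.
  have -> : a + d + (b - a) = b + d by ring.
  by rewrite [action b t + _]addrC; apply; lra.
have sub := action_subgradient f_C2 f_convex f_superlinear beta_continuous.
(* the slope at c makes one of the inequalities strict *)
have [c cE] : exists c, c = (a + b) / 2 by eexists.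
have h1 := sub b c t t0; have h2 := sub c a t t0.
have h3 := sub (a + d) (b + d) t t0.
have m1 : momentum c t < momentum b t by apply: momentum_strict_mono => //; lra.
have m2 : momentum b t <= momentum (a + d) t by apply: momentum_mono.
have [s sE] : exists s, s = (b - a) / 2 by eexists.
have s0 : 0 < s by lra.
have E1 : c - b = - s by lra.
have E2 : a - c = - s by lra.
have E3 : b + d - (a + d) = 2 * s by lra.
move: h1 h2 h3; rewrite E1 E2 E3.
have : momentum c t * s < momentum b t * s by rewrite ltr_pM2r.
have : momentum b t * s <= momentum (a + d) t * s by rewrite ler_pM2r.
by rewrite !mulrN; lra.
Qed.

(** If the minimisers were in the opposite order, exchanging them would lower the sum
    of the two costs, by strict convexity of the action. *)
Lemma minimizer_mono x1 x2 t y1 y2 : 0 < t -> x1 < x2 ->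
  is_minimizer (cost x1 t) y1 -> is_minimizer (cost x2 t) y2 -> y1 <= y2.
Proof.
move=> t0 x12 min1 min2; rewrite leNgt; apply/negP => y21.
have := min1 y2; have := min2 y1; rewrite /cost => h2 h1.
have ab : x1 - y1 < x1 - y2 by lra.
have d0 : 0 < x2 - x1 by lra.
have := action_four_points t0 ab d0.
have -> : x1 - y1 + (x2 - x1) = x2 - y1 by ring.
have -> : x1 - y2 + (x2 - x1) = x2 - y2 by ring.
lra.
Qed.

(** The minimisers form a nonempty bounded closed set, which contains its supremum. *)
Lemma largest_minimizerP x t : 0 < t ->
  is_minimizer (cost x t) (largest_minimizer x t) /\
  forall y, is_minimizer (cost x t) y -> y <= largest_minimizer x t.
Proof.
move=> t0; set S := [set y | is_minimizer (cost x t) y].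
have [y0 y0min] := minimizer_exists x t0.
have supS : has_sup S.
  split; first by exists y0.
  exists (x - displacement (- M) t) => y /(minimizer_bounds t0); lra.
have ubS y : S y -> y <= sup S by move=> Sy; apply: ub_le_sup => //; case: supS.
have Ssup : is_minimizer (cost x t) (sup S).
  have /choice[u uP] : forall n, exists y, S y /\ sup S - n.+1%:R^-1 < y.
    move=> n; have n0 : 0 < n.+1%:R^-1 :> R by rewrite invr_gt0.
    by have [y Sy yl] := sup_adherent n0 supS; exists y.
  have uS : u n @[n --> \oo] --> sup S.
    apply: (@squeeze_cvgr _ _ _ _ (fun n => sup S - n.+1%:R^-1) (fun=> sup S)).
    - apply: nearW => n; have [Su un] := uP n.
      by rewrite (ltW un) ubS.
    - rewrite -[X in _ --> X]subr0; apply: cvgB; first exact: cvg_cst.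
      exact: cvg_harmonic.
    - exact: cvg_cst.
  have uc n : cost x t (u n) = cost x t y0.
    have [Su _] := uP n; apply/eqP; rewrite eq_le; apply/andP; split; first exact: Su.
    exact: y0min.
  have c1 : cost x t (u n) @[n --> \oo] --> cost x t (sup S).
    by apply: (continuous_seq _ uS); exact: continuous_cost.
  have c2 : cost x t (u n) @[n --> \oo] --> cost x t y0.
    by rewrite (_ : (fun n => _) = (fun=> cost x t y0)); [exact: cvg_cst|exact/funext].
  by move=> z; rewrite (cvg_unique _ c1 c2)//; exact: y0min.
have E : Ffun f beta u0 x ^~ t = cost x t by apply/funext => y; rewrite costE.
rewrite largest_minimizerE /ystar E.
set P := [set y | _]; have : P (get P).
  by apply: getPex; exists (sup S); split => // z; exact: ubS.
by [].
Qed.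

Lemma value_min x t y : 0 < t -> value x t <= cost x t y.
Proof. by move=> t0; exact: (largest_minimizerP x t0).1. Qed.

Lemma largest_minimizer_mono x1 x2 t : 0 < t -> x1 <= x2 ->
  largest_minimizer x1 t <= largest_minimizer x2 t.
Proof.
move=> t0; rewrite le_eqVlt => /predU1P[->//|x12].
exact: minimizer_mono t0 x12 (largest_minimizerP _ t0).1 (largest_minimizerP _ t0).1.
Qed.

Lemma optimal_momentum_bound x t : 0 < t -> `|optimal_momentum x t| <= M.
Proof.
by move=> t0; rewrite ler_norml; exact: minimizer_momentum (largest_minimizerP x t0).1.
Qed.

(** Monotone functions are Borel. *)
Lemma locbdd_meas_optimal_momentum t : 0 < t ->
  locbdd_meas (fun x => optimal_momentum x t).
Proof.
move=> t0; apply: locbdd_meas_borel; last first.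
  by move=> r; exists M => x _; exact: optimal_momentum_bound.
have mY : measurable_fun setT (fun x => largest_minimizer x t).
  by apply: nondecreasing_measurable => // x y; exact: largest_minimizer_mono.
have cm : continuous (fun z => momentum z t).
  by move=> z; apply/continuous_seqP => u uz; apply: cvg_momentum => //; exact: cvg_cst.
apply: (@measurableT_comp _ _ _ _ _ _ (fun z => momentum z t)).
  exact: continuous_measurable_fun.
exact: measurable_funB.
Qed.

(** Translating the minimiser together with [x] changes the potential only. *)
Lemma value_lipschitz t x y : 0 < t -> `|value y t - value x t| <= M * `|y - x|.
Proof.
move=> t0; have half a b : value b t - value a t <= M * `|b - a|.
  have := value_min b (largest_minimizer a t + (b - a)) t0.
  rewrite [value a t]/value /cost; set Y := largest_minimizer a t.
  have -> : b - (Y + (b - a)) = a - Y by ring.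
  have := potential_lipschitz Y (Y + (b - a)).
  have -> : Y + (b - a) - Y = b - a by ring.
  by rewrite ler_norml => /andP[_]; lra.
have h1 := half x y; have h2 := half y x; rewrite [`|x - y|]distrC in h2.
by rewrite ler_norml; apply/andP; split; lra.
Qed.

Definition unique_minimizer x t := forall y, is_minimizer (cost x t) y ->
  y = largest_minimizer x t.

Definition straddling r r' t := [set x | exists y1 y2,
  [/\ is_minimizer (cost x t) y1, is_minimizer (cost x t) y2, y1 <= r & r' <= y2]].

(** Monotonicity: minimisers at distinct points cannot both leave a common interval
    [[r, r']] of positive length in between. *)
Lemma straddling_subsingleton r r' t x1 x2 : 0 < t -> r < r' ->
  straddling r r' t x1 -> straddling r r' t x2 -> x1 = x2.
Proof.
move=> t0 rr' [y1 [y2 [m1 m2 h1 h2]]] [z1 [z2 [n1 n2 k1 k2]]].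
case: (ltgtP x1 x2) => // x12.
  by have := minimizer_mono t0 x12 m2 n1; lra.
by have := minimizer_mono t0 x12 n2 m1; lra.
Qed.

Lemma not_unique_straddling x t : 0 < t -> ~ unique_minimizer x t ->
  exists r r' : rat, ratr r < ratr r' :> R /\ straddling (ratr r) (ratr r') t x.
Proof.
move=> t0 /existsNP[y /not_implyP[ymin yY]].
have [Ymin Ymax] := largest_minimizerP x t0.
have yltY : y < largest_minimizer x t.
  by rewrite lt_neqAle Ymax// andbT; apply/eqP.
have [r rI] := rat_in_itvoo yltY; move: rI; rewrite in_itv/= => /andP[yr rY].
have [r' r'I] := rat_in_itvoo rY; move: r'I; rewrite in_itv/= => /andP[rr' r'Y].
exists r, r'; split => //; exists y, (largest_minimizer x t).
by split => //; exact: ltW.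
Qed.

Lemma negligible_not_unique t : 0 < t ->
  (@completed_lebesgue_measure R).-negligible [set x | ~ unique_minimizer x t].
Proof.
move=> t0; pose F n := if (unpickle n : option (rat * rat)) is Some (r, r') then
  [set x | ratr r < ratr r' :> R /\ straddling (ratr r) (ratr r') t x] else set0.
suff h : (@completed_lebesgue_measure R).-negligible (\bigcup_n F n).
  apply: negligibleS h => x /(not_unique_straddling t0)[r [r' H]].
  by exists (pickle (r, r')); [exact: I|rewrite /F pickleK; exact: H].
apply: negligible_bigcup => n; rewrite /F.
case: unpickle => [[r r']|]; last exact: negligible_set0.
set S := (X in negligible _ X); have [->|/set0P[x [rr' xS]]] := eqVneq S set0.
  exact: negligible_set0.
exists [set x]; split.
- by apply: borel_lebesgue_measurable; exact: measurable_set1.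
- exact: (lebesgue_measure_set1 x).
- by move=> y [_ yS] /=; exact: straddling_subsingleton t0 rr' yS xS.
Qed.

(** The minimisers stay in a segment, so it suffices that every cluster point is a
    minimiser for the limit data. Costs converge at each fixed point, and passing from
    a minimiser to a nearby cluster point costs at most a constant times the distance. *)
Lemma cvg_largest_minimizer (x_ t_ : nat -> R) x t : 0 < t ->
  unique_minimizer x t -> (forall n, 0 < t_ n) ->
  x_ n @[n --> \oo] --> x -> t_ n @[n --> \oo] --> t ->
  largest_minimizer (x_ n) (t_ n) @[n --> \oo] --> largest_minimizer x t.
Proof.
move=> t0 uniq t_0 x_x t_t; set Y := largest_minimizer x t.
pose Y_ n := largest_minimizer (x_ n) (t_ n).
have dcvg q : displacement q (t_ n) @[n --> \oo] --> displacement q t.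
  by apply: seq_continuous2_displacement => //; exact: cvg_cst.
have [X xX] := cvg_seq_le_bound x_x.
have [D dD] := cvg_seq_le_bound (dcvg M).
have [D' dD'] := cvg_seq_le_bound (dcvg (- M)).
have [B BE] : exists B, B = X + D + D' + `|Y| + 1 by eexists.
have YB n : - B < Y_ n < B.
  have := minimizer_bounds (t_0 n) (largest_minimizerP (x_ n) (t_0 n)).1.
  have := xX n; have := dD n; have := dD' n; rewrite !ler_norml => h1 h2 h3 h4.
  have := normr_ge0 Y; rewrite /Y_; lra.
have Bnbhs : nbhs Y `[- B, B]%classic.
  apply: (@filterS _ _ _ `]- B, B[%classic); first exact: subset_itv_oo_cc.
  apply: near_in_itvoo; rewrite in_itv/=.
  have := normr_ge0 X; have := xX 0%N; have := dD 0%N; have := dD' 0%N.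
  have := ler_norm Y; have := ler_norm (- Y); rewrite normrN.
  have := normr_ge0 (x_ 0%N); have := normr_ge0 (displacement M (t_ 0%N)).
  have := normr_ge0 (displacement (- M) (t_ 0%N)); lra.
have F1 : \forall n \near \oo, `[- B, B]%classic (Y_ n).
  by apply: nearW => n /=; rewrite in_itv/=; have := YB n; lra.
have cl y : cluster (Y_ @ \oo) y -> y = Y.
  move=> cly; apply: uniq => z; apply/ler_addgt0Pr => e e0.
  have mcvg : momentum (x_ n - y) (t_ n) @[n --> \oo] --> momentum (x - y) t.
    by apply: cvg_momentum => //; apply: cvgB => //; exact: cvg_cst.
  have [L mL] := cvg_seq_le_bound mcvg.
  have L0 : 0 <= L := le_trans (normr_ge0 _) (mL 0%N).
  have M0 := bound_ge0.
  have e3 : 0 < e / 3 by lra.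
  have LM1 : 0 < L + M + 1 by lra.
  have ccvg v : cost (x_ n) (t_ n) v @[n --> \oo] --> cost x t v.
    by apply: cvg_cost => //; exact: cvg_cst.
  have /cvg_seq_epsP/(_ _ e3) nearcost1 := ccvg y.
  have /cvg_seq_epsP/(_ _ e3) nearcost2 := ccvg z.
  pose good n := `|cost (x_ n) (t_ n) y - cost x t y| <= e / 3 /\
                 `|cost (x_ n) (t_ n) z - cost x t z| <= e / 3.
  have FA : \forall n \near \oo, [set v | exists2 n, good n & v = Y_ n] (Y_ n).
    by apply: filterS2 nearcost1 nearcost2 => n h1 h2; exists n.
  have [_ [[n [good1 good2] ->] yn]] :=
    cly _ _ FA (nbhsx_ballx y _ (divr_gt0 e3 LM1)).
  move: yn; rewrite /ball/= ltr_pdivlMr// => yn.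
  have hmin := value_min (x_ n) z (t_0 n); rewrite /value -/(Y_ n) in hmin.
  have sub := action_subgradient f_C2 f_convex f_superlinear beta_continuous
    (x_ n - y) (x_ n - Y_ n) (t_0 n).
  rewrite (_ : x_ n - Y_ n - _ = y - Y_ n) in sub; last by ring.
  have sub' : `|momentum (x_ n - y) (t_ n) * (y - Y_ n)| <= L * `|y - Y_ n|.
    by rewrite normrM ler_wpM2r.
  have pot := potential_lipschitz (Y_ n) y.
  move: good1 good2 sub' pot; rewrite !ler_norml /cost in hmin *.
  move=> good1 good2 sub' pot.
  have : L * `|y - Y_ n| + M * `|y - Y_ n| <= e / 3.
    rewrite -mulrDl mulrC; apply: le_trans (ltW yn).
    by rewrite ler_wpM2l//; lra.
  by lra.
apply: (@compact_cluster_set1 _ Y (Y_ @ \oo) `[- B, B]%classic) => //.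
  exact: segment_compact.
apply/seteqP; split=> [y /cl//|_ ->].
have [y [_ cly]] := @segment_compact _ (- B) B (Y_ @ \oo) _ F1.
by rewrite -(cl y cly).
Qed.

Lemma cvg_optimal_momentum (x_ t_ : nat -> R) x t : 0 < t ->
  unique_minimizer x t -> (forall n, 0 < t_ n) ->
  x_ n @[n --> \oo] --> x -> t_ n @[n --> \oo] --> t ->
  optimal_momentum (x_ n) (t_ n) @[n --> \oo] --> optimal_momentum x t.
Proof.
move=> t0 uniq t_0 x_x t_t; apply: cvg_momentum => //; apply: cvgB => //.
exact: cvg_largest_minimizer.
Qed.

(** The value at one point is compared with the cost, at that point, of the minimiser
    of the other point; both bounds have slope tending to the optimal momentum. *)
Lemma value_is_derive x t : 0 < t -> unique_minimizer x t ->
  is_derive x 1 (fun z => value z t) (optimal_momentum x t).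
Proof.
move=> t0 uniq; apply/is_derive_seqP => u ux u_x.
have cY : largest_minimizer (u n) t @[n --> \oo] --> largest_minimizer x t.
  by apply: cvg_largest_minimizer => //; exact: cvg_cst.
have sub := action_subgradient f_C2 f_convex f_superlinear beta_continuous.
have ux0 n : u n - x != 0 by rewrite subr_eq0.
set Y := largest_minimizer x t; pose Y_ n := largest_minimizer (u n) t.
apply: (@cvg_quotient_squeeze _ (fun n => momentum (x - Y_ n) t * (u n - x))
  (fun n => momentum (u n - Y) t * (u n - x))) => //.
- move=> n; apply/andP; split.
    have := value_min x (Y_ n) t0; have := sub (x - Y_ n) (u n - Y_ n) t t0.
    rewrite [value (u n) t]/value /cost -/(Y_ n).
    have -> : u n - Y_ n - (x - Y_ n) = u n - x by ring.
    by lra.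
  have := value_min (u n) Y t0; have := sub (u n - Y) (x - Y) t t0.
  rewrite [value x t]/value /cost -/Y.
  have -> : x - Y - (u n - Y) = - (u n - x) by ring.
  by rewrite mulrN; lra.
- under eq_fun do rewrite mulfK//.
  apply: cvg_momentum => //; last exact: cvg_cst.
  by apply: cvgB => //; exact: cvg_cst.
- under eq_fun do rewrite mulfK//.
  apply: cvg_momentum => //; last exact: cvg_cst.
  by apply: cvgB => //; exact: cvg_cst.
Qed.

Lemma value_time_increment x t t' : 0 < t -> 0 < t' ->
  - (energy (momentum (x - largest_minimizer x t') t) t'
     - energy (momentum (x - largest_minimizer x t') t) t)
    <= value x t' - value x t
    <= - (energy (momentum (x - largest_minimizer x t) t') t'
          - energy (momentum (x - largest_minimizer x t) t') t).
Proof.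
move=> t0 t'0; apply/andP; split; last first.
  have := value_min x (largest_minimizer x t) t'0.
  have := action_increment_le f_C2 f_convex f_superlinear beta_continuous
    (x - largest_minimizer x t) t0 t'0.
  by rewrite [value x t]/value /cost; lra.
have := value_min x (largest_minimizer x t') t0.
have := action_increment_ge f_C2 f_convex f_superlinear beta_continuous
  (x - largest_minimizer x t') t0 t'0.
by rewrite [value x t']/value /cost; lra.
Qed.

Lemma cvg_value_time_quotient x t (t_ : nat -> R) : 0 < t ->
  unique_minimizer x t -> (forall n, 0 < t_ n) -> (forall n, t_ n != t) ->
  t_ n @[n --> \oo] --> t ->
  (value x (t_ n) - value x t) / (t_ n - t) @[n --> \oo] -->
    - energy_density (optimal_momentum x t) t.
Proof.
move=> t0 uniq t_0 tnt t_t.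
have dt n : t_ n - t != 0 by rewrite subr_eq0.
have cY : largest_minimizer x (t_ n) @[n --> \oo] --> largest_minimizer x t.
  by apply: cvg_largest_minimizer => //; exact: cvg_cst.
have quot (q_ : nat -> R) : q_ n @[n --> \oo] --> optimal_momentum x t ->
    - (energy (q_ n) (t_ n) - energy (q_ n) t) / (t_ n - t) @[n --> \oo] -->
    - energy_density (optimal_momentum x t) t.
  move=> q_q; under eq_fun do rewrite mulNr !energyE.
  apply: cvgN; apply: cvg_oriented_integral_quotient => //.
  exact: seq_continuous2_energy_density.
apply: cvg_quotient_squeeze (quot _ _) (quot _ _) => //.
- by move=> n; exact: value_time_increment.
- apply: cvg_momentum => //; last exact: cvg_cst.
  by apply: cvgB => //; exact: cvg_cst.
- by apply: cvg_momentum => //; exact: cvg_cst.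
Qed.

(** The constant is uniform in [x] because the momenta involved lie in
    [[- (M + 1), M + 1]] once [t'] is close to [t]. *)
Lemma value_time_lipschitz t : 0 < t -> exists d C : R, [/\ 0 < d, d <= t &
  forall x t', `|t' - t| < d -> `|value x t' - value x t| <= C * `|t' - t|].
Proof.
move=> t0; have dcvg q : {for t, continuous (displacement q)}.
  exact: seq_continuous2_snd (seq_continuous2_displacement f_C2 beta_continuous) t.
have near_d q e : 0 < e -> exists2 d, 0 < d & forall t', `|t' - t| < d ->
    `|displacement q t' - displacement q t| <= e.
  by move=> e0; have /cvgr_ballP/(_ _ e0) := dcvg q.
have [g gE] : exists g, g = displacement (M + 1) t - displacement M t by eexists.
have [h hE] : exists h, h = displacement (- M) t - displacement (- (M + 1)) t by eexists.
have M1 : M < M + 1 by lra.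
have M1' : - (M + 1) < - M by lra.
have g0 : 0 < g.
  by have := displacement_strict_mono f_C2 f_convex beta_continuous t0 M1; lra.
have h0 : 0 < h.
  by have := displacement_strict_mono f_C2 f_convex beta_continuous t0 M1'; lra.
have g2 : 0 < g / 2 by lra.
have h2 : 0 < h / 2 by lra.
have [d1 d10 d1P] := near_d M _ g2.
have [d2 d20 d2P] := near_d (M + 1) _ g2.
have [d3 d30 d3P] := near_d (- M) _ h2.
have [d4 d40 d4P] := near_d (- (M + 1)) _ h2.
have [C CP] := bounded2_energy_density f_C2 beta_continuous (M + 1) (2 * t).
pose d := Num.min t (Num.min (Num.min d1 d2) (Num.min d3 d4)).
exists d, C; split.
- by rewrite !lt_min t0 d10 d20 d30 d40.
- by rewrite ge_min lexx.
move=> x t'; rewrite !lt_min => /andP[tt' /andP[/andP[t1 t2] /andP[t3 t4]]].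
have {}d1P := d1P _ t1; have {}d2P := d2P _ t2.
have {}d3P := d3P _ t3; have {}d4P := d4P _ t4.
move: d1P d2P d3P d4P; rewrite !ler_norml => d1P d2P d3P d4P.
have tt'' := tt'; rewrite ltr_norml in tt''.
have t'0 : 0 < t' by lra.
have := value_time_increment x t0 t'0.
set q := momentum _ t; set p := momentum _ t' => /=.
have qM : `|q| <= M + 1.
  have := minimizer_bounds t'0 (largest_minimizerP x t'0).1.
  by move=> b; rewrite ler_norml momentum_le// momentum_ge//; lra.
have pM : `|p| <= M + 1.
  have := minimizer_bounds t0 (largest_minimizerP x t0).1.
  by move=> b; rewrite ler_norml momentum_le// momentum_ge//; lra.
have bnd r : `|r| <= M + 1 -> `|energy r t' - energy r t| <= C * `|t' - t|.
  move=> rM; rewrite !energyE; apply: norm_oriented_integralB_le.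
    exact: locbdd_meas_energy_density.
  move=> z zt; apply: CP => //.
  apply: le_trans (_ : `|t| + `|t' - t| <= _); first exact: norm_le_sum.
  by rewrite (gtr0_norm t0); lra.
have := bnd _ qM; have := bnd _ pM; rewrite !ler_norml; lra.
Qed.

(** Above, the competitor with momentum zero; below, the action is at least
    [M |z|] up to the energies of [M] and [- M], and absorbs the variation of the
    potential. *)
Lemma value_initial t x : 0 < t ->
  `|value x t - potential x| <= `|energy 0 t| + M * `|displacement 0 t|
    + `|energy M t| + `|energy (- M) t|.
Proof.
move=> t0; have M0 := bound_ge0.
have age q z := action_ge f_C2 f_convex f_superlinear beta_continuous q z t0.
have n1 := normr_ge0 (energy 0 t); have n2 := normr_ge0 (energy M t).
have n3 := normr_ge0 (energy (- M) t).
have n4 : 0 <= M * `|displacement 0 t| by rewrite mulr_ge0.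
have l1 := ler_norm (- energy 0 t); have l2 := ler_norm (energy M t).
have l3 := ler_norm (energy (- M) t); rewrite normrN in l1.
rewrite ler_norml; apply/andP; split.
  rewrite /value /cost; set Y := largest_minimizer x t.
  have := potential_lipschitz x Y; rewrite ler_norml => /andP[+ _].
  have := age M (x - Y); have := age (- M) (x - Y).
  have [z0|z0] := leP 0 (x - Y); rewrite distrC.
    by rewrite (ger0_norm z0) !mulNr; lra.
  by rewrite (ltr0_norm z0) mulrN !mulNr; lra.
(* the competitor x - z has momentum zero *)
set z := displacement 0 t.
have := value_min x (x - z) t0; rewrite /cost subKr.
have mz : momentum z t = 0.
  apply/eqP; rewrite eq_le momentum_le// momentum_ge//.
  by rewrite lexx.
have := potential_lipschitz x (x - z).
rewrite (_ : x - z - x = - z); last by ring.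
rewrite normrN ler_norml => /andP[_].
by rewrite /action mz mul0r -/z in n4 *; lra.
Qed.

Definition positive_time : set (R * R) := [set p | 0 < p.2].

Lemma measurable_positive_time : measurable positive_time.
Proof.
have -> : positive_time = [set: R] `*` `]0, +oo[%classic.
  by apply/seteqP; split => p; rewrite /= in_itv/= andbT => //= -[].
exact: measurableX.
Qed.

(** The supremum of [q z - K q t] may be taken over rational [q]. *)
Lemma measurable_action y :
  measurable_fun positive_time (fun p : R * R => action (p.1 - y) p.2).
Proof.
move=> mD; apply: (measurability _ (RGenOInfty.measurableE R)) => //.
move=> _ [_ [c ->] <-].
have -> : positive_time `&` (fun p : R * R => action (p.1 - y) p.2) @^-1` `]c, +oo[ =
    \bigcup_(q : rat) (positive_time `&`
      (fun p : R * R => ratr q * (p.1 - y) - energy (ratr q) p.2) @^-1` `]c, +oo[).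
  apply/seteqP; split => -[x t]/=.
    rewrite /positive_time/= in_itv/= andbT => -[t0 cact].
    set z := x - y in cact *.
    have cq : continuous (fun q => q * z - energy q t).
      move=> q; apply: cvgB; first by apply: cvgM; [exact: cvg_id|exact: cvg_cst].
      exact: seq_continuous2_fst (seq_continuous2_energy f_C2 beta_continuous) q.
    have gap : 0 < (action z t - c) / 2 by lra.
    have /cvgr_ballP/(_ _ gap)[d d0 dP] := cq (momentum z t).
    have md : momentum z t < momentum z t + d by lra.
    have [q] := rat_in_itvoo md; rewrite in_itv/= => qI.
    exists q => //=; split => //; rewrite in_itv/= andbT.
    have qd : `|ratr q - momentum z t| < d by rewrite ger0_norm; lra.
    have := dP _ qd; rewrite ler_norml /= => qm.
    have aE : action z t = momentum z t * z - energy (momentum z t) t by [].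
    by rewrite -/z; rewrite -aE in qm; lra.
  move=> [q _]; rewrite /positive_time/= !in_itv/= !andbT => -[t0 h]; split => //.
  exact: lt_le_trans h (action_ge f_C2 f_convex f_superlinear beta_continuous _ _ t0).
apply: bigcupT_measurable_rat => q.
have mE : measurable_fun setT (energy (ratr q)).
  apply: continuous_measurable_fun.
  exact: seq_continuous2_snd (seq_continuous2_energy f_C2 beta_continuous).
have mF : measurable_fun positive_time
    (fun p : R * R => ratr q * (p.1 - y) - energy (ratr q) p.2).
  apply: (@measurable_funS _ _ _ _ setT) => //.
  apply: measurable_funB; last by apply: measurableT_comp mE _; exact: measurable_snd.
  by apply: measurable_funM => //; apply: measurable_funB => //; exact: measurable_fst.
exact: mF.
Qed.

Lemma measurable_cost y :
  measurable_fun positive_time (fun p : R * R => cost p.1 p.2 y).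
Proof. by apply: measurable_funD; [exact: measurable_action|]. Qed.

(** A countable form of the statement that [[a, b]] contains a minimiser at a positive
    time: no value of the cost is below all its values on the rationals of [[a, b]] by
    a positive amount. *)
Definition minimized_within (a b : R) : set (R * R) :=
  \bigcap_(s : rat) \bigcap_(k : nat) \bigcup_(y in [set y : rat | a <= ratr y <= b])
    (positive_time `&`
     [set p : R * R | cost p.1 p.2 (ratr y) < cost p.1 p.2 (ratr s) + k.+1%:R^-1]).

Lemma measurable_minimized_within a b : measurable (minimized_within a b).
Proof.
rewrite -[X in measurable X]setCK setC_bigcap; apply: measurableC.
apply: bigcupT_measurable_rat => s; apply: measurableC.
apply: bigcapT_measurable => k.
rewrite bigcup_mkcond; apply: bigcupT_measurable_rat => y; case: ifP => // _.
have lt_fun : measurable_fun positive_time (fun p : R * R =>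
    cost p.1 p.2 (ratr y) < cost p.1 p.2 (ratr s) + k.+1%:R^-1).
  apply: measurable_fun_ltr; first exact: measurable_cost.
  by apply: measurable_funD => //; exact: measurable_cost.
by have := lt_fun measurable_positive_time [set true] Logic.I.
Qed.

(** A minimum of the continuous cost over [[a, b]] is a lower bound on the rationals,
    hence everywhere. *)
Lemma minimized_withinP a b x t : minimized_within a b (x, t) -> a <= b ->
  exists2 y, a <= y <= b & is_minimizer (cost x t) y.
Proof.
move=> H ab; have t0 : 0 < t by have [] := H 0 I 0%N I => ? _ [].
have cc : continuous (cost x t) by exact: continuous_cost.
have [y yab ymin] := EVT_min ab (continuous_subspaceT cc).
exists y; first by move: yab; rewrite in_itv.
move=> z; rewrite leNgt; apply/negP => zy.
have gap : 0 < (cost x t y - cost x t z) / 2 by lra.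
have /cvgr_ballP/(_ _ gap)[d d0 dP] := cc z.
have zd : z < z + d by lra.
have [s] := rat_in_itvoo zd; rewrite in_itv/= => sI.
have sd : `|ratr s - z| < d by rewrite ger0_norm; lra.
have sz : `|cost x t (ratr s) - cost x t z| <= _ := dP _ sd.
rewrite ler_norml in sz.
have [k kP] : exists k : nat, k.+1%:R^-1 < (cost x t y - cost x t z) / 2.
  by have [k _ kP] := near_infty_natSinv_lt (PosNum gap); exists k; apply: kP => /=.
have [r rab [_ /= rs]] := H s I k I.
have rs' := lt_trans rs (ler_ltD (lexx (cost x t (ratr s))) kP).
by have := ymin (ratr r); rewrite in_itv/= => /(_ rab); lra.
Qed.

Lemma minimized_within_minimizer a b x t y : 0 < t -> a < y < b ->
  is_minimizer (cost x t) y -> minimized_within a b (x, t).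
Proof.
move=> t0 /andP[ay yb] ymin s _ k _.
have [e eE] : exists e : R, e = k.+1%:R^-1 by eexists.
have e0 : 0 < e by rewrite eE invr_gt0.
have k0 : 0 < e / 2 by lra.
have /cvgr_ballP/(_ _ k0)[d d0 dP] := @continuous_cost x t t0 y.
have yb' : y < Num.min b (y + d) by rewrite lt_min yb; lra.
have [r] := rat_in_itvoo yb'; rewrite in_itv/= lt_min => /andP[yr /andP[rb rd]].
exists r => /=; first by lra.
split => //=; rewrite -eE; have ryd : `|ratr r - y| < d by rewrite ger0_norm; lra.
have ry : `|cost x t (ratr r) - cost x t y| <= _ := dP _ ryd.
by rewrite ler_norml in ry; have := ymin (ratr s); lra.
Qed.

(** Two minimisers at [(x, t)] lie in two rational intervals, separated by a gap.
    The sets of such points are Borel and have sections at constant [t] with at most one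
    point, so they are null for the product measure integrated in the order [x], then
    [t]. *)
Lemma ae_unique_minimizer :
  {ae (@lebesgue_measure R \x @lebesgue_measure R)%E, forall p : R * R,
    0 < p.2 -> unique_minimizer p.1 p.2}.
Proof.
pose bad (r1 r2 r3 r4 : rat) : set (R * R) :=
  minimized_within (ratr r1) (ratr r2) `&` minimized_within (ratr r3) (ratr r4).
have bad0 r1 r2 r3 r4 : ratr r1 < ratr r2 :> R -> ratr r2 < ratr r3 :> R ->
    ratr r3 < ratr r4 :> R ->
    (@lebesgue_measure R \x @lebesgue_measure R)%E (bad r1 r2 r3 r4) = 0%E.
  move=> r12 r23 r34.
  have mbad : measurable (bad r1 r2 r3 r4).
    by apply: measurableI; exact: measurable_minimized_within.
  rewrite (@product_measure_unique _ _ _ _ _ _ _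
    (@lebesgue_measure R \x^ @lebesgue_measure R)%E)//=; last first.
    by move=> A B mA mB; rewrite product_measure2E.
  rewrite /product_measure2; apply: integral0_eq => t _ /=.
  suff [x sub] : exists x, ysection (bad r1 r2 r3 r4) t `<=` [set x].
    apply/eqP; rewrite -measure_le0 -(lebesgue_measure_set1 x).
    by apply: le_measure; rewrite ?inE//; exact: measurable_ysection.
  have [t0|t0] := ltP 0 t; last first.
    exists 0 => x; rewrite /ysection/= inE => -[/(_ 0 I 0%N I)[? _ [/= ]]].
    by rewrite /positive_time/= ltNge t0.
  have str x : ysection (bad r1 r2 r3 r4) t x -> straddling (ratr r2) (ratr r3) t x.
    rewrite /ysection/= inE => -[/minimized_withinP/(_ (ltW r12))[y1 y1P m1]].
    move=> /minimized_withinP/(_ (ltW r34))[y2 y2P m2].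
    by exists y1, y2; split => //; lra.
  have [E|/set0P[x xS]] := eqVneq (ysection (bad r1 r2 r3 r4) t) set0.
    by exists 0; rewrite E.
  exists x => x' x'S; exact: straddling_subsingleton t0 r23 (str _ x'S) (str _ xS).
pose F n := if (unpickle n : option (rat * rat * rat * rat)) is Some (r1, r2, r3, r4) then
  if [&& ratr r1 < ratr r2 :> R, ratr r2 < ratr r3 :> R & ratr r3 < ratr r4 :> R]
  then bad r1 r2 r3 r4 else set0 else set0.
suff h : (@lebesgue_measure R \x @lebesgue_measure R)%E.-negligible (\bigcup_n F n).
  apply: negligibleS h => -[x t] /= /not_implyP[t0 /existsNP[y /not_implyP[ymin yY]]].
  have [Ymin Ymax] := largest_minimizerP x t0.
  have yltY : y < largest_minimizer x t.
    by rewrite lt_neqAle Ymax// andbT; apply/eqP.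
  have y1 : y - 1 < y by lra.
  have Y1 : largest_minimizer x t < largest_minimizer x t + 1 by lra.
  have [r1] := rat_in_itvoo y1; rewrite in_itv/= => /andP[_ r1y].
  have [r2] := rat_in_itvoo yltY; rewrite in_itv/= => /andP[yr2 r2Y].
  have [r3] := rat_in_itvoo r2Y; rewrite in_itv/= => /andP[r23 r3Y].
  have [r4] := rat_in_itvoo Y1; rewrite in_itv/= => /andP[Yr4 _].
  exists (pickle (r1, r2, r3, r4)); [exact: I|rewrite /F pickleK].
  rewrite (lt_trans r1y yr2) r23 (lt_trans r3Y Yr4)/=; split.
    by apply: minimized_within_minimizer ymin => //; rewrite r1y.
  by apply: minimized_within_minimizer Ymin => //; rewrite r3Y.
apply: negligible_bigcup => n; rewrite /F.
case: unpickle => [[[[r1 r2] r3] r4]|]; last exact: negligible_set0.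
case: ifP => [/and3P[r12 r23 r34]|_]; last exact: negligible_set0.
exists (bad r1 r2 r3 r4); split => //.
- by apply: measurableI; exact: measurable_minimized_within.
- exact: bad0.
Qed.

End Minimizers.

(** * From the Hamilton-Jacobi equation to the weak formulation *)

Section WeakFormulation.
Variable R : realType.
Implicit Types (x y z t s r : R).
Variables (V w k : R -> R -> R) (a u0 eta : R -> R) (N : R -> set R) (M : R).
Hypotheses (a_locbdd : locbdd_meas a) (u0_locbdd : locbdd_meas u0).
Hypotheses (k_continuous : seq_continuous2 k) (k_bounded : bounded2 k).
Hypothesis N_negligible : forall t, 0 < t ->
  (@completed_lebesgue_measure R).-negligible (N t).
Hypothesis w_measurable : forall t, 0 < t -> locbdd_meas (fun x => w x t).
Hypothesis w_bound : forall x t, 0 < t -> `|w x t| <= M.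
Hypothesis w_cvg : forall x t (t_ : nat -> R), 0 < t -> ~ N t x ->
  (forall n, 0 < t_ n) -> t_ n @[n --> \oo] --> t ->
  w x (t_ n) @[n --> \oo] --> w x t.
Hypothesis V_lipschitz : forall x y t, 0 < t ->
  `|V y t - V x t| <= M * `|y - x|.
Hypothesis V_derive : forall x t, 0 < t -> ~ N t x ->
  is_derive x 1 (fun z => V z t) (w x t).
Hypothesis V_time_lipschitz : forall t, 0 < t -> exists d C : R,
  [/\ 0 < d, d <= t & forall x t', `|t' - t| < d ->
    `|V x t' - V x t| <= C * `|t' - t|].
Hypothesis V_time_quotient : forall x t (t_ : nat -> R), 0 < t -> ~ N t x ->
  (forall n, 0 < t_ n) -> (forall n, t_ n != t) -> t_ n @[n --> \oo] --> t ->
  (V x (t_ n) - V x t) / (t_ n - t) @[n --> \oo] --> - k (w x t) t.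
Hypotheses (eta_continuous : {for 0, continuous eta}) (eta0 : eta 0 = 0).
Hypothesis V_initial : forall x t, 0 < t ->
  `|V x t - oriented_integral u0 x| <= eta t.

Variables (phi phix phit : R -> R -> R) (X T B : R).
Hypotheses (X_ge0 : 0 <= X) (T_ge0 : 0 <= T).
Hypotheses (phi_continuous : seq_continuous2 phi)
  (phix_continuous : seq_continuous2 phix)
  (phit_continuous : seq_continuous2 phit).
Hypothesis phi_derive_x : forall x t, 0 < t ->
  is_derive x 1 (fun z => phi z t) (phix x t).
Hypothesis phi_derive_t : forall x t, 0 < t ->
  is_derive t 1 (fun s => phi x s) (phit x t).
Hypothesis phi_support_x : forall x t, X <= `|x| -> phi x t = 0.
Hypothesis phi_support_t : forall x t, T <= t ->
  [/\ phi x t = 0, phix x t = 0 & phit x t = 0].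
Hypotheses (phi_bound : forall x t, `|phi x t| <= B)
  (phix_bound : forall x t, `|phix x t| <= B)
  (phit_bound : forall x t, `|phit x t| <= B).

Let J g : R := \lint_(x in `[- X, X]) g x.

Let XX : - X <= X. Proof. by have := X_ge0; lra. Qed.
Let B_ge0 : 0 <= B. Proof. exact: le_trans (normr_ge0 _) (phi_bound 0 0). Qed.
Let M_ge0 : 0 <= M. Proof. exact: le_trans (normr_ge0 _) (w_bound 0 ltr01). Qed.

(** For [t <= 0] the limit of the values at [t > 0] is taken, which makes the pairing
    continuous on the whole line. *)
Definition pairing t :=
  if 0 < t then J (fun x => w x t * phi x t) else J (fun x => u0 x * phi x 0).
Definition flux_pairing t :=
  J (fun x => w x t * phit x t + k (w x t) t * phix x t).

Let mphi t : locbdd_meas (fun x => phi x t).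
Proof. by apply: locbdd_meas_continuous; exact: seq_continuous2_fst. Qed.
Let mphix t : locbdd_meas (fun x => phix x t).
Proof. by apply: locbdd_meas_continuous; exact: seq_continuous2_fst. Qed.
Let mphit t : locbdd_meas (fun x => phit x t).
Proof. by apply: locbdd_meas_continuous; exact: seq_continuous2_fst. Qed.

Let mV t : 0 < t -> locbdd_meas (fun x => V x t).
Proof.
move=> t0; apply: locbdd_meas_continuous => x; apply/cvgr_ballP => e e0.
exists (e / (M + 1)); first by rewrite divr_gt0//; have := M_ge0; lra.
move=> y; rewrite ltr_pdivlMr; last by have := M_ge0; lra.
move=> yx; apply: le_trans (V_lipschitz x y t0) (le_trans _ (ltW yx)).
by rewrite mulrC ler_wpM2l//; lra.
Qed.

Lemma V_increment x y t : 0 < t -> x <= y ->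
  \lint_(z in `[x, y]) w z t = V y t - V x t.
Proof.
move=> t0 xy.
apply: (@lint_ae_derivative _ (fun z => V z t) (fun z => w z t) x y M (N t)) => //.
- exact: w_measurable.
- by move=> z z'; exact: V_lipschitz.
- exact: N_negligible.
- by move=> z _ Nz; exact: V_derive.
Qed.

(** No boundary terms: [phi] vanishes at both ends. *)
Lemma lint_primitive_phix g s c : locbdd_meas g -> 0 < s ->
  J (fun x => g x * phi x s) = - J (fun x => (c + oriented_integral g x) * phix x s).
Proof.
move=> mg s0; rewrite /J.
have cphix : continuous (fun x => phix x s) by exact: seq_continuous2_fst.
rewrite (lint_by_parts c mg XX (fun x => phi_derive_x x s0) cphix).
by rewrite !phi_support_x ?normrN ?ger0_norm ?lexx//; ring.
Qed.

(** [w] is the derivative of [V] in [x], so [V] equals [V 0 t] plus the primitive of [w]. *)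
Lemma lint_w_phi t s : 0 < t -> 0 < s ->
  J (fun x => w x t * phi x s) = - J (fun x => V x t * phix x s).
Proof.
move=> t0 s0; rewrite (lint_primitive_phix (V 0 t) (w_measurable t0) s0).
congr (- _); apply: eq_Rintegral => x _; congr (_ * _).
rewrite /oriented_integral; have [x0|x0] := leP 0 x.
  by rewrite V_increment//; ring.
by rewrite V_increment ?ltW//; ring.
Qed.

(** [w] has no derivative in time, so its increment is turned into one of [V]. The
    time increment of [phi] stays paired with [w], so that no mixed second derivative of
    [phi] appears. *)
Lemma pairing_increment t s : 0 < t -> 0 < s ->
  pairing s - pairing t =
  J (fun x => - (V x s - V x t) * phix x s + w x t * (phi x s - phi x t)).
Proof.
move=> t0 s0; rewrite /pairing t0 s0.
have mw := w_measurable t0.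
have m1 : locbdd_meas (fun x => w x t * phi x s) by exact: locbdd_measM.
have m2 : locbdd_meas (fun x => w x t * phi x t) by exact: locbdd_measM.
have m3 : locbdd_meas (fun x => V x s * phix x s) by apply: locbdd_measM; first exact: mV.
have m4 : locbdd_meas (fun x => V x t * phix x s) by apply: locbdd_measM; first exact: mV.
have -> : J (fun x => w x s * phi x s) - J (fun x => w x t * phi x t) =
   (J (fun x => V x t * phix x s) - J (fun x => V x s * phix x s)) +
   (J (fun x => w x t * phi x s) - J (fun x => w x t * phi x t)).
  rewrite [J (fun x => w x s * _)]lint_w_phi//.
  by rewrite [J (fun x => w x t * phi x s)]lint_w_phi//; ring.
rewrite /J -!lint_subr_segment// -lintD_segment; try exact: locbdd_measB.
by apply: eq_Rintegral => x _; ring.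
Qed.

(** Dominated convergence of the difference quotients: those of [V] converge off a null
    set and are bounded uniformly in [x]. *)
Lemma pairing_is_derive t : 0 < t -> is_derive t 1 pairing (flux_pairing t).
Proof.
move=> t0; have [d [C [d0 dt VC]]] := V_time_lipschitz t0.
apply: (is_derive_seq_near d0) => u ud u_t.
have un0 n : 0 < u n by have := (ud n).2; rewrite ltr_norml; lra.
have unt n : u n != t := (ud n).1.
have unt0 n : u n - t != 0 by rewrite subr_eq0.
pose q n x := - ((V x (u n) - V x t) / (u n - t)) * phix x (u n)
  + w x t * ((phi x (u n) - phi x t) / (u n - t)).
have mq n : locbdd_meas (q n).
  apply: locbdd_measD; apply: locbdd_measM => //.
  - rewrite (_ : (fun x => _) = fun x => - (u n - t)^-1 * (V x (u n) - V x t)).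
      by apply: locbdd_measZ; apply: locbdd_measB; exact: mV.
    by apply/funext => x; rewrite mulNr mulrC.
  - exact: w_measurable.
  - rewrite (_ : (fun x => _) = fun x => (u n - t)^-1 * (phi x (u n) - phi x t)).
      by apply: locbdd_measZ; apply: locbdd_measB.
    by apply/funext => x; rewrite mulrC.
rewrite (_ : (fun n => _) = (fun n => J (q n))); last first.
  apply/funext => n; rewrite pairing_increment// mulrC /J -lintZ_segment.
    by apply: eq_Rintegral => x _; rewrite /q; field.
  apply: locbdd_measD; apply: locbdd_measM => //.
  - by apply: locbdd_measN; apply: locbdd_measB; exact: mV.
  - exact: w_measurable.
  - exact: locbdd_measB.
have kw_meas : locbdd_meas (fun x => k (w x t) t).
  apply: (@locbdd_meas_comp R (fun q => k q t)); last exact: w_measurable.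
  exact: seq_continuous2_fst.
apply: (@lint_dominated R q _ (- X) X (N t) (C * B + M * B)) => //.
- apply: locbdd_measD; apply: locbdd_measM => //; exact: w_measurable.
- exact: N_negligible.
- move=> x _ Nx; rewrite addrC; apply: cvgD.
    apply: cvgM; last by apply: phix_continuous => //; exact: cvg_cst.
    rewrite -[X in _ --> X]opprK; apply: cvgN; exact: V_time_quotient.
  apply: cvgM; first exact: cvg_cst.
  by have /is_derive_seqP := phi_derive_t x t0; apply.
- move=> n x _; rewrite /q; apply: le_trans (ler_normD _ _) _.
  have utp : 0 < `|u n - t| by rewrite normr_gt0.
  rewrite !normrM normrN !normfV; apply: lerD; apply: ler_pM => //.
  + by rewrite normrM normfV ler_pdivrMr// VC//; exact: (ud n).2.
  + exact: w_bound.
  + rewrite ler_pdivrMr//.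
    have mvt r s : 0 < r -> r <= s -> `|phi x s - phi x r| <= B * `|s - r|.
      move=> r0 rs.
      have dphi y : y \in `]r, s[ -> is_derive y 1 (phi x) (phit x y).
        by rewrite in_itv/= => ry; apply: phi_derive_t; lra.
      have cphi : {within `[r, s], continuous (phi x)}.
        by apply: continuous_subspaceT; exact: seq_continuous2_snd.
      have [c _ ->] := MVT_segment rs dphi cphi.
      by rewrite normrM ler_wpM2r.
    have [tu|ut] := leP t (u n); first exact: mvt.
    by rewrite distrC [`|u n - t|]distrC; apply: mvt => //; exact: ltW.
Qed.

Lemma flux_pairing_continuous t : 0 < t -> {for t, continuous flux_pairing}.
Proof.
move=> t0; apply: (continuous_seq_near t0) => u ud u_t.
have un0 n : 0 < u n by have := ud n; rewrite ltr_norml; lra.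
have [C kC] := k_bounded M (2 * t).
have kw_meas s : 0 < s -> locbdd_meas (fun x => k (w x s) s).
  move=> s0; apply: (@locbdd_meas_comp R (fun q => k q s)); last exact: w_measurable.
  exact: seq_continuous2_fst.
apply: (@lint_dominated R (fun n x => w x (u n) * phit x (u n)
   + k (w x (u n)) (u n) * phix x (u n)) _ (- X) X (N t) (M * B + C * B)).
- move=> n; apply: locbdd_measD; apply: locbdd_measM => //; first exact: w_measurable.
  exact: kw_meas.
- apply: locbdd_measD; apply: locbdd_measM => //; first exact: w_measurable.
  exact: kw_meas.
- exact: N_negligible.
- move=> x _ Nx; have wx := w_cvg t0 Nx un0 u_t.
  by apply: cvgD; apply: cvgM => //; [apply: phit_continuous|apply: k_continuous
    |apply: phix_continuous] => //; exact: cvg_cst.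
- move=> n x _; apply: le_trans (ler_normD _ _) _; rewrite !normrM.
  apply: lerD; apply: ler_pM => //; first exact: w_bound.
  apply: kC; first exact: w_bound.
  by have := ud n; rewrite ltr_norml ger0_norm//; [lra|exact: ltW].
Qed.

Lemma flux_pairing_bound r : exists C, forall t, 0 < t -> t <= r ->
  `|flux_pairing t| <= C.
Proof.
have [C kC] := k_bounded M r; exists ((M * B + C * B) * (X - - X)) => t t0 tr.
apply: norm_lint_segment_le => //.
  apply: locbdd_measD; apply: locbdd_measM => //; first exact: w_measurable.
  apply: (@locbdd_meas_comp R (fun q => k q t)); last exact: w_measurable.
  exact: seq_continuous2_fst.
move=> x _; apply: le_trans (ler_normD _ _) _; rewrite !normrM.
apply: lerD; apply: ler_pM => //; first exact: w_bound.
by apply: kC; [exact: w_bound|rewrite ger0_norm// ltW].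
Qed.

Let initial_pairing t := J (fun x => u0 x * phi x t).

Let initial_pairing_continuous : continuous initial_pairing.
Proof.
move=> t; apply/continuous_seqP => s s_t.
have [C uC] := u0_locbdd.2 X.
apply: (@lint_dominated R (fun n x => u0 x * phi x (s n)) _ (- X) X set0 (C * B)).
- by move=> n; exact: locbdd_measM.
- exact: locbdd_measM.
- exact: negligible_set0.
- move=> x _ _; apply: cvgM; first exact: cvg_cst.
  by apply: phi_continuous => //; exact: cvg_cst.
- by move=> n x xX; rewrite normrM ler_pM// uC// ler_norml.
Qed.

Lemma pairing_initial t : 0 < t ->
  `|pairing t - initial_pairing t| <= eta t * B * (X - - X).
Proof.
move=> t0; rewrite /pairing t0 lint_w_phi// /initial_pairing.
rewrite (lint_primitive_phix 0 u0_locbdd t0) opprK.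
have mU : locbdd_meas (fun x => (0 + oriented_integral u0 x) * phix x t).
  apply: locbdd_measM => //; apply: locbdd_measD; first exact: locbdd_meas_cst.
  by apply: locbdd_meas_continuous; exact: continuous_oriented_integral.
have mVp : locbdd_meas (fun x => V x t * phix x t) by apply: locbdd_measM => //; exact: mV.
rewrite addrC /J -lint_subr_segment//; apply: norm_lint_segment_le => //.
  exact: locbdd_measB.
move=> x _; rewrite -mulrBl normrM ler_pM// add0r distrC; exact: V_initial.
Qed.

Lemma pairing_continuous : continuous pairing.
Proof.
move=> t; have [t0|t0|<-] := ltgtP 0 t.
- exact: is_derive_cont (pairing_is_derive t0).
- have nt0 : 0 < - t by lra.
  apply: (continuous_seq_near nt0) => s sd _.
  have -> : (fun n => pairing (s n)) = (fun=> pairing t); last exact: cvg_cst.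
  apply/funext => n; rewrite /pairing !ifF//; apply/negbTE; rewrite -leNgt//.
    by rewrite ltW.
  by have := sd n; rewrite ltr_norml; lra.
apply/cvgr_ballP => e e0.
have e2 : 0 < e / 2 by lra.
have Y0 : 0 < B * (X - - X) + 1.
  have : 0 <= B * (X - - X) by rewrite mulr_ge0//; have := X_ge0; lra.
  by lra.
have /cvgr_ballP/(_ _ (divr_gt0 e2 Y0))[d d0 dP] := eta_continuous.
have /cvgr_ballP/(_ _ e2)[c c0 cP] := @initial_pairing_continuous 0.
exists (Num.min d c); first by rewrite lt_min d0.
move=> s; rewrite lt_min => /andP[/dP sd /cP sc].
have p0 : pairing 0 = initial_pairing 0 by rewrite /pairing ltxx.
have /orP[s0|s0] : (s <= 0) || (0 < s) by case: ltP.
  by rewrite /pairing [0 < s]ltNge s0 ltxx/= subrr normr0 ltW.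
rewrite -[_ - _](subrKA (initial_pairing s)) p0.
apply: le_trans (ler_normD _ _) _; rewrite [leRHS]splitr; apply: lerD => //.
apply: le_trans (pairing_initial s0) _.
move: sd; rewrite eta0 subr0 ler_pdivlMr// => sd; apply: le_trans sd.
rewrite -mulrA; apply: ler_pM => //; rewrite ?ler_norm//.
- exact: le_trans (normr_ge0 _) (V_initial 0 s0).
- by rewrite mulr_ge0//; have := X_ge0; lra.
- by rewrite lerDl.
Qed.

Definition weight t := expR (oriented_integral a t).
Definition weighted_flux t := if 0 < t then weight t * flux_pairing t else 0.

Let weight_continuous : continuous weight.
Proof.
move=> t; apply: continuous_comp; last exact: continuous_expR.
exact: continuous_oriented_integral.
Qed.

Let weighted_flux_locbdd : locbdd_meas weighted_flux.
Proof.
apply: locbdd_meas_borel.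
  rewrite (_ : weighted_flux = (fun t => weight t * flux_pairing t) \_ `]0, +oo[).
    apply/(measurable_restrictT _ _).1; first exact: measurable_itv.
    apply: open_continuous_measurable_fun; first exact: interval_open.
    move=> t; rewrite inE/= in_itv/= andbT => t0.
    by apply: cvgM; [exact: weight_continuous|exact: flux_pairing_continuous].
  apply/funext => t; rewrite /weighted_flux /patch.
  by rewrite mem_setE in_itv/= andbT.
move=> r; have [C wC] := continuous_locbdd weight_continuous r.
have [D fD] := flux_pairing_bound r; exists (`|C| * `|D|) => t tr.
rewrite /weighted_flux; case: ifP => t0; last by rewrite normr0 mulr_ge0.
rewrite normrM ler_pM//; first exact: le_trans (wC _ tr) (ler_norm _).
apply: le_trans (ler_norm D); apply: fD => //.
by apply: le_trans tr; exact: ler_norm.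
Qed.

Let weighted_pairing t := weight t * pairing t.

Let weighted_pairing_continuous : continuous weighted_pairing.
Proof.
by move=> t; apply: cvgM; [exact: weight_continuous|exact: pairing_continuous].
Qed.

(** [e^beta W - \int a e^beta W] has the continuous derivative [e^beta W'] for [t > 0]
    and is continuous at [0]; its increment over [[0, T]] is the claimed integral, since
    [W T = 0] and [W 0] is the initial pairing. *)
Lemma weak_identity : locbdd_meas (fun t => weight t * pairing t) /\
  \lint_(t in `[0, T]) weighted_flux t + \lint_(x in `[- X, X]) (u0 x * phi x 0) =
  - \lint_(t in `[0, T]) (a t * (weight t * pairing t)).
Proof.
have mp := locbdd_meas_continuous weighted_pairing_continuous.
have map : locbdd_meas (fun t => a t * weighted_pairing t) by exact: locbdd_measM.
split=> //.
set D := fun t => weighted_pairing t - oriented_integral (fun t => a t * weighted_pairing t) t.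
have cD : continuous D.
  move=> t; apply: cvgB; first exact: weighted_pairing_continuous.
  exact: continuous_oriented_integral.
have fluxE : \lint_(t in `[0, T]) weighted_flux t = D T - D 0.
  apply: lint_is_derive => //.
  - move=> t /andP[t0 _]; rewrite /weighted_flux t0.
    apply: is_derive_sub_oriented_integralM => //; first exact: weighted_pairing_continuous.
    have [C wC] := oriented_integral_lipschitz t a_locbdd.
    (* frozen at t, the exponential is tangent to its linearisation in beta *)
    have d1 : is_derive t 1 (fun y => expR (oriented_integral a y)
        - expR (oriented_integral a t) * oriented_integral a y) 0.
      apply: (@is_derive0_comp_lipschitz R (fun b => expR b - weight t * b)
        (oriented_integral a) t C wC).
      apply: is_derive_eq; rewrite /GRing.scale/= /weight; lra.
    have d2 : is_derive t 1 (fun y => pairing y - pairing t) (flux_pairing t).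
      have := is_deriveB (pairing_is_derive t0) (is_derive_cst (pairing t) t 1).
      by rewrite subr0; congr (is_derive _ _ _ _).
    have d3 := is_derive_continuousM (@weight_continuous t) d2 (subrr _).
    have d4 := is_deriveM d1 (is_derive_cst (pairing t) t 1).
    have := is_deriveD d3 d4.
    rewrite /GRing.scale/= !mulr0 !addr0.
    congr (is_derive _ _ _ _); apply/funext => y.
    rewrite /= !fctE /cst /weighted_pairing /weight.
    set e := expR (oriented_integral a y); set e' := expR (oriented_integral a t).
    set o := oriented_integral a y; ring.
  - move=> t /andP[t0 _]; apply: (continuous_seq_near t0) => s sd s_t.
    have s0 n : 0 < s n by have := sd n; rewrite ltr_norml; lra.
    rewrite /weighted_flux t0.
    rewrite (_ : (fun n => _) = fun n => weight (s n) * flux_pairing (s n)).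
      apply: cvgM; first exact: continuous_seq (@weight_continuous t) s_t.
      exact: continuous_seq (flux_pairing_continuous t0) s_t.
    by apply/funext => n; rewrite s0.
  - by move=> t _; exact: cD.
have pT : pairing T = 0.
  have J0 g : (forall x, g x = 0) -> J g = 0.
    move=> g0; rewrite -[RHS](mul0r (X - - X)) -(lint_cst_segment 0 XX).
    by apply: eq_Rintegral => x _; exact: g0.
  rewrite /pairing; case: ltP => T0; apply: J0 => x.
    by have [-> _ _] := phi_support_t x (lexx T); rewrite mulr0.
  by have [-> _ _] := phi_support_t x T0; rewrite mulr0.
rewrite fluxE -(oriented_integralB map T_ge0) /D /weighted_pairing pT.
rewrite oriented_integral0// /weight oriented_integral0// expR0 /pairing ltxx /J.
ring.
Qed.

End WeakFormulation.

(** * Test functions on the closed half-plane *)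

Section TestFunctions.
Variable R : realType.
Implicit Types (g phi : R * R -> R) (x t X T : R).

(** The values at [t < 0] repeat the trace at [t = 0], so that a function continuous on
    the closed half-plane becomes continuous on the plane. *)
Definition half_extension g x t := g (x, Num.max t 0).

Lemma half_extensionE g x t : 0 <= t -> half_extension g x t = g (x, t).
Proof. by move=> t0; rewrite /half_extension; congr (g (_, _)); exact/max_idPl. Qed.

Lemma half_extension_neg g x t : t <= 0 -> half_extension g x t = half_extension g x 0.
Proof. by move=> t0; rewrite /half_extension maxxx; congr (g (_, _)); exact/max_idPr. Qed.

Lemma cvg_max0 (t_ : nat -> R) t : t_ n @[n --> \oo] --> t ->
  Num.max (t_ n) 0 @[n --> \oo] --> Num.max t 0.
Proof.
move=> /cvg_seq_epsP t_t; apply/cvg_seq_epsP => e e0.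
apply: filterS (t_t e e0) => n; apply: le_trans.
have := ler_norm (t_ n - t); have := ler_norm (- (t_ n - t)); rewrite normrN.
by case: (leP (t_ n) 0) => h1; case: (leP t 0) => h2; rewrite ler_norml; lra.
Qed.

Lemma half_extension_seq_continuous2 g : {within @upper_half R, continuous g} ->
  seq_continuous2 (half_extension g).
Proof.
move=> /subspace_continuousP cg q_ t_ q t q_q t_t A nA.
have m0 x s : upper_half (x, Num.max s 0) by rewrite /upper_half/= le_max lexx orbT.
have cp : (q_ n, Num.max (t_ n) 0) @[n --> \oo] --> (q, Num.max t 0).
  exact: (cvg_pair q_q (cvg_max0 t_t)).
have H : \forall n \near \oo, upper_half (q_ n, Num.max (t_ n) 0) ->
    A (g (q_ n, Num.max (t_ n) 0)) := cp _ (cg _ (m0 q t) A nA).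
have : \forall n \near \oo, A (half_extension g (q_ n) (t_ n)).
  by apply: filterS H => n; apply; exact: m0.
by [].
Qed.

Lemma half_extension_bounded2 g : {within @upper_half R, continuous g} ->
  bounded2 (half_extension g).
Proof.
move=> cg Q T; set K := `[- Q, Q]%classic `*` `[0, `|T|]%classic.
have cK : compact K by apply: compact_setX; exact: segment_compact.
have cgK : {within K, continuous g}.
  apply: continuous_subspaceW cg => -[x t] [_] /=.
  by rewrite /upper_half/= in_itv/= => /andP[].
have [C [_ /(_ (C + 1))]] := compact_bounded (continuous_compact cgK cK).
rewrite ltrDl ltr01 => /(_ isT) H; exists (C + 1) => q t qQ tT.
apply: H; exists (q, Num.max t 0) => //; split=> /=.
  by rewrite in_itv/= -ler_norml.
rewrite in_itv/= le_max lexx orbT/= ge_max normr_ge0 andbT.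
by apply: le_trans (le_trans tT (ler_norm _)); exact: ler_norm.
Qed.

(** Derivatives of a test function are defined by difference quotients for [t > 0] only;
    their vanishing at [t = 0] follows by continuity. *)
Lemma half_extension0 g x : {within @upper_half R, continuous g} ->
  (forall t, 0 < t -> half_extension g x t = 0) ->
  forall t, half_extension g x t = 0.
Proof.
move=> cg g0 t; have [t0|t0] := ltP 0 t; first exact: g0.
rewrite half_extension_neg//.
have h1 : half_extension g x (0 + n.+1%:R^-1) @[n --> \oo] --> half_extension g x 0.
  apply: half_extension_seq_continuous2 => //; first exact: cvg_cst.
  exact: cvg_addr_invS.
have h2 : half_extension g x (0 + n.+1%:R^-1) @[n --> \oo] --> (0 : R).
  rewrite (_ : (fun n => _) = fun=> 0); first exact: cvg_cst.
  by apply/funext => n; rewrite g0// add0r invr_gt0.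
exact: cvg_unique h1 h2.
Qed.

Lemma is_derive_near_eq (f g : R -> R) x l d : 0 < d ->
  (forall y, `|y - x| < d -> f y = g y) -> is_derive x 1 f l -> is_derive x 1 g l.
Proof.
move=> d0 fg /is_derive_epsP H; apply/is_derive_epsP => e /H[c c0 cH].
exists (Num.min d c); first by rewrite lt_min d0.
move=> y; rewrite lt_min => /andP[yd yc]; rewrite -!fg ?subrr ?normr0//.
exact: cH.
Qed.

Lemma is_derive_near0 (f : R -> R) x l d : 0 < d ->
  (forall y, `|y - x| < d -> f y = 0) -> is_derive x 1 f l -> l = 0.
Proof.
move=> d0 f0 /(is_derive_near_eq d0 f0) [_ <-].
by have [_ ->] := is_derive_cst (0 : R) x (1 : R).
Qed.

Lemma compact_bounded_pair (A : set (R * R)) : compact A ->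
  exists r : R, forall x t, A (x, t) -> `|x| <= r /\ `|t| <= r.
Proof.
move=> /compact_bounded[r [_ /(_ (r + 1))]]; rewrite ltrDl ltr01 => /(_ isT) H.
exists (r + 1) => x t /H; rewrite /= prod_normE/= ge_max => /andP[]; by split.
Qed.

Lemma test_function_extension phi : test_function phi ->
  exists (phix phit : R -> R -> R) (X T B : R),
  let psi := half_extension phi in
  [/\ [/\ 0 <= X & 0 <= T],
      [/\ seq_continuous2 psi, seq_continuous2 phix & seq_continuous2 phit],
      [/\ forall x t, 0 < t -> is_derive x 1 (fun z => psi z t) (phix x t) &
          forall x t, 0 < t -> is_derive t 1 (fun s => psi x s) (phit x t)],
      [/\ forall x t, X <= `|x| -> [/\ psi x t = 0, phix x t = 0 & phit x t = 0] &
          forall x t, T <= t -> [/\ psi x t = 0, phix x t = 0 & phit x t = 0]] &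
      forall x t, [/\ `|psi x t| <= B, `|phix x t| <= B & `|phit x t| <= B]].
Proof.
move=> [/(_ 1%N)[/= cphi [phix [phit [dx dt [cphix _] [cphit _]]]]]].
move=> /compact_bounded_pair[r rP].
have supp x t : 0 <= t -> r < `|x| \/ r < `|t| -> phi (x, t) = 0.
  move=> t0 h; apply/eqP; apply: contrapT => /negP n0.
  have [h1 h2] : `|x| <= r /\ `|t| <= r by apply: rP; apply: subset_closure.
  by case: h; rewrite ltNge ?h1 ?h2.
(* the margin 1 makes the function vanish near the points of the boundary *)
pose X := `|r| + 1; have rX : r < X by have := ler_norm r; rewrite /X; lra.
have X0 : 0 < X by have := normr_ge0 r; rewrite /X; lra.
have dpx x t : 0 < t -> is_derive x 1 (fun z => half_extension phi z t)
    (half_extension phix x t).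
  move=> t0; rewrite half_extensionE ?ltW//.
  rewrite (_ : (fun z => _) = fun z => phi (z, t)); first exact: dx.
  by apply/funext => z; rewrite half_extensionE// ltW.
have dpt x t : 0 < t -> is_derive t 1 (fun s => half_extension phi x s)
    (half_extension phit x t).
  move=> t0; rewrite half_extensionE ?ltW//.
  apply: (is_derive_near_eq t0 _ (dt x t t0)) => s; rewrite ltr_norml => st.
  by rewrite half_extensionE//; lra.
have psi_x x t : r < `|x| -> half_extension phi x t = 0.
  by move=> rx; apply: supp; [rewrite le_max lexx orbT|left].
have psi_t x t : r < t -> 0 < t -> half_extension phi x t = 0.
  move=> rt t0; rewrite half_extensionE ?ltW//; apply: supp; first exact: ltW.
  by right; rewrite gtr0_norm.
have far (y x : R) : X <= `|x| -> `|y - x| < 1 -> r < `|y|.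
  move=> Xx yx; have := ler_norm r; rewrite -(subKr y x) in Xx.
  by have := ler_normB y (y - x); rewrite /X in Xx; lra.
exists (half_extension phix), (half_extension phit), X, X.
have [B1 B1P] := half_extension_bounded2 cphi X X.
have [B2 B2P] := half_extension_bounded2 cphix X X.
have [B3 B3P] := half_extension_bounded2 cphit X X.
have sx x t : X <= `|x| -> [/\ half_extension phi x t = 0,
    half_extension phix x t = 0 & half_extension phit x t = 0].
  move=> Xx; split.
  - by apply: psi_x; exact: lt_le_trans Xx.
  - apply: half_extension0 => // s s0; apply: (is_derive_near0 ltr01 _ (dpx x s s0)).
    by move=> y yx; apply: psi_x; exact: far yx.
  - apply: half_extension0 => // s s0; apply: (is_derive_near0 ltr01 _ (dpt x s s0)).
    by move=> y _; apply: psi_x; exact: lt_le_trans Xx.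
have st x t : X <= t -> [/\ half_extension phi x t = 0,
    half_extension phix x t = 0 & half_extension phit x t = 0].
  move=> Xt; have t0 : 0 < t by exact: lt_le_trans Xt.
  split.
  - by apply: psi_t => //; exact: lt_le_trans Xt.
  - apply: (is_derive_near0 ltr01 _ (dpx x t t0)) => y _.
    by apply: psi_t => //; exact: lt_le_trans Xt.
  - apply: (is_derive_near0 ltr01 _ (dpt x t t0)) => y.
    rewrite ltr_norml => yt; have := ler_norm r; have := normr_ge0 r.
    by rewrite /X in Xt; move=> ? ?; apply: psi_t; lra.
exists (`|B1| + `|B2| + `|B3|); split => //.
- by split; exact: ltW.
- by split; exact: half_extension_seq_continuous2.
move=> x t.
have nB1 := normr_ge0 B1; have nB2 := normr_ge0 B2; have nB3 := normr_ge0 B3.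
have lB1 := ler_norm B1; have lB2 := ler_norm B2; have lB3 := ler_norm B3.
wlog t0 : t / 0 <= t => [wl|].
  have [|t0] := leP 0 t; first exact: wl.
  have tl := ltW t0; have [] := wl 0 (lexx 0).
  by rewrite ![half_extension _ x t]half_extension_neg.
have [Xx|xX] := leP X `|x|.
  by have [-> -> ->] := sx x t Xx; rewrite !normr0; split; lra.
have [Xt|tX] := leP X t.
  by have [-> -> ->] := st x t Xt; rewrite !normr0; split; lra.
have tX' : `|t| <= X by rewrite ger0_norm// ltW.
have := B1P x t (ltW xX) tX'; have := B2P x t (ltW xX) tX'.
have := B3P x t (ltW xX) tX'; split; lra.
Qed.

End TestFunctions.

(** * Essentially bounded sources *)

Section EssentiallyBounded.
Variable R : realType.
Notation mu := (@completed_lebesgue_measure R).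
Notation LT := (caratheodory_type (@wlength R idfun)^*%mu).

(** Modifying the source on a null set makes it bounded everywhere; with the value zero
    at [t <= 0] its oriented primitive vanishes there, as [primitive alpha] does. *)
Lemma Linfty_halfline_truncation (alpha : R -> R) : Linfty_halfline alpha ->
  exists a : R -> R, [/\ locbdd_meas a, forall t, t <= 0 -> a t = 0,
    lebesgue_measurable_fun setT (alpha \_ `[0, +oo[) &
    {ae mu, forall t : LT, (alpha \_ `[0, +oo[) t = a t}].
Proof.
set v := alpha \_ `[0, +oo[; move=> /andP[mv vfin].
have {}mv : lebesgue_measurable_fun setT v by move: mv; rewrite inE.
have {vfin} : ('N[mu]_+oo[EFin \o v] < +oo)%E by move: vfin; rewrite inE.
rewrite unlock ifT; last first.
  apply: (@lt_le_trans _ _ (mu `[0, 1]%classic)).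
    rewrite -[X in (_ < X)%E]/(lebesgue_measure `[0, 1]%classic).
    by rewrite lebesgue_measure_itv/= lte_fin ltr01 -EFinD lte_fin; lra.
  by apply: le_measure => //; rewrite inE; [exact: measurable_itv_lebesgue|exact: measurableT].
set e := ess_sup _ _ => elty; have := ess_sup_ge mu (abse \o (EFin \o v)).
rewrite -/e => -[Z [mZ Z0 ZP]].
have vC t : ~ Z t -> `|v t| <= fine e.
  move=> nZ; have /= vle : (`|(v t)%:E| <= e)%E.
    by apply: contrapT => h; apply: nZ; apply: ZP.
  rewrite -lee_fin fineK// ge0_fin_numE//.
  exact: le_trans vle.
pose S := [set t : R | 0 < t /\ `|v t| <= fine e].
have mS : measurable (S : set LT).
  have -> : S = `]0, +oo[%classic `&` (fun t => `|v t|) @^-1` `]-oo, fine e].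
    by apply/seteqP; split => t /=; rewrite !in_itv/= andbT.
  apply: measurableI; first exact: measurable_itv_lebesgue.
  rewrite -[X in measurable X]setTI.
  have mnv : lebesgue_measurable_fun setT (fun t => `|v t|).
    by apply: measurableT_comp mv; exact: normr_measurable.
  by apply: mnv; [exact: measurableT|exact: measurable_itv].
exists (v \_ S); split => //.
- split; last first.
    move=> r; exists `|fine e| => t _; rewrite /patch; case: ifP => [|_].
      by rewrite inE => -[_ h]; apply: le_trans h (ler_norm _).
    by rewrite normr0.
  by apply/(measurable_restrictT _ mS); exact: measurable_funS mv.
- move=> t t0; rewrite /patch memNset// => -[]; lra.
- exists (Z `|` [set 0]); split.
  + apply: measurableU => //; rewrite -set_itv1; exact: measurable_itv_lebesgue.
  + apply: null_set_setU => //; last exact: (lebesgue_measure_set1 0).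
    by rewrite -set_itv1; exact: measurable_itv_lebesgue.
  + move=> t /= vt; have [->|tn0] := eqVneq t 0; [by right|left].
    apply: contrapT => nZ; apply: vt; rewrite /patch.
    case: ifPn => // /negP; rewrite inE => nS.
    rewrite /v /patch; case: ifPn => //; rewrite inE/= in_itv/= andbT => t0.
    by exfalso; apply: nS; split; [rewrite lt_neqAle eq_sym tn0|exact: vC].
Qed.

End EssentiallyBounded.

(** * Change of domain and of representative *)

Section SetIntegral.
Variable R : realType.
Implicit Types (D E : set R) (g h : R -> R).

Lemma eq_lint D g h : (forall x, D x -> g x = h x) ->
  \lint_(x in D) g x = \lint_(x in D) h x.
Proof. by move=> gh; apply: eq_Rintegral => x; rewrite inE; exact: gh. Qed.

Lemma lint_support D E g : (forall x, D x -> ~ E x -> g x = 0) ->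
  (forall x, E x -> ~ D x -> g x = 0) -> \lint_(x in D) g x = \lint_(x in E) g x.
Proof.
move=> DE ED; rewrite /lebesgue_integral Rintegral_mkcond [RHS]Rintegral_mkcond.
congr Rintegral; apply/funext => x; rewrite /patch.
case: ifPn => [|/negP]; case: ifPn => [|/negP]; rewrite !inE// => h1 h2.
- exact: DE.
- by rewrite ED.
Qed.

Lemma ae_eq_lint D g h : measurable (D : set (caratheodory_type (@wlength R idfun)^*%mu)) ->
  lebesgue_measurable_fun setT g -> lebesgue_measurable_fun setT h ->
  {ae (@completed_lebesgue_measure R), forall x, g x = h x} ->
  \lint_(x in D) g x = \lint_(x in D) h x.
Proof.
move=> mD mg mh gh; rewrite /lebesgue_integral /Rintegral; congr fine.
apply: ae_eq_integral.
- exact: mD.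
- by apply/measurable_EFinP; exact: measurable_funS mg.
- by apply/measurable_EFinP; exact: measurable_funS mh.
- have [Z [mZ Z0 ZP]] := gh; exists Z; split; [exact: mZ|exact: Z0|].
  by move=> x /= nE; apply: ZP => /= E; apply: nE => _; rewrite E.
Qed.

End SetIntegral.

(** * The minimisation formula solves the balance law *)

Section Assembly.
Variables (R : realType) (f a u0 : R -> R) (M : R).
Hypotheses (f_C2 : C2 f) (f_convex : strictly_convex f)
  (f_superlinear : superlinear f) (a_locbdd : locbdd_meas a)
  (u0_measurable : lebesgue_measurable_fun setT u0)
  (u0_bounded : forall x, `|u0 x| <= M).

Let beta := oriented_integral a.
Let beta_continuous : continuous beta.
Proof. exact: continuous_oriented_integral. Qed.

(** The abstract identity applied to the value function and the optimal momentum; the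
    exceptional set at time [t] consists of the points with several minimisers. *)
Lemma solution_weak_identity (phi phix phit : R -> R -> R) (X T B : R) :
  0 <= X -> 0 <= T ->
  seq_continuous2 phi -> seq_continuous2 phix -> seq_continuous2 phit ->
  (forall x t : R, 0 < t -> is_derive x 1 (fun z => phi z t) (phix x t)) ->
  (forall x t : R, 0 < t -> is_derive t 1 (fun s => phi x s) (phit x t)) ->
  (forall x t : R, X <= `|x| -> phi x t = 0) ->
  (forall x t : R, T <= t -> [/\ phi x t = 0, phix x t = 0 & phit x t = 0]) ->
  (forall x t : R, [/\ `|phi x t| <= B, `|phix x t| <= B & `|phit x t| <= B]) ->
  let w := optimal_momentum f beta u0 in
  locbdd_meas (fun t => weight a t * pairing w u0 phi X t) /\
  \lint_(t in `[0, T]) weighted_flux w (energy_density f beta) a phix phit X t +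
  \lint_(x in `[- X, X]) (u0 x * phi x 0) =
  - \lint_(t in `[0, T]) (a t * (weight a t * pairing w u0 phi X t)).
Proof.
move=> X0 T0 cphi cphix cphit dx dt sx st bphi w.
pose eta t := `|energy f beta 0 t| + M * `|displacement f beta 0 t|
    + `|energy f beta M t| + `|energy f beta (- M) t|.
have c_energy q : continuous (energy f beta q).
  exact: seq_continuous2_snd (seq_continuous2_energy f_C2 beta_continuous).
have c_disp q : continuous (displacement f beta q).
  exact: seq_continuous2_snd (seq_continuous2_displacement f_C2 beta_continuous).
have c_eta : {for 0, continuous eta}.
  have cn g : continuous g -> `|g t| @[t --> (0 : R)] --> `|g 0 : R|.
    by move=> cg; apply: cvg_norm; exact: cg.
  apply: cvgD; last exact: cn.
  apply: cvgD; last exact: cn.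
  apply: cvgD; first exact: cn.
  by apply: cvgM; [exact: cvg_cst|exact: cn].
have energy0 q : energy f beta q 0 = 0.
  rewrite energyE oriented_integral0//.
  exact: locbdd_meas_energy_density.
have disp0 q : displacement f beta q 0 = 0.
  by rewrite displacementE oriented_integral0//; exact: locbdd_meas_speed.
apply: (@weak_identity R (value f beta u0) w (energy_density f beta) a u0 eta
  (fun t => [set x | ~ unique_minimizer f beta u0 x t]) M _ _ _ _ _ _ _ _ _ _ _ _ _ _ _
  phi phix phit X T B) => //.
- by apply: (locbdd_meas_u0 u0_measurable u0_bounded).
- exact: seq_continuous2_energy_density.
- exact: bounded2_energy_density.
- by move=> t t0; exact: (negligible_not_unique f_C2 f_convex f_superlinear beta_continuous
    u0_measurable u0_bounded t0).
- by move=> t t0; exact: (locbdd_meas_optimal_momentum f_C2 f_convex f_superlinear beta_continuous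
    u0_measurable u0_bounded t0).
- by move=> x t t0; exact: (optimal_momentum_bound f_C2 f_convex f_superlinear beta_continuous
    u0_measurable u0_bounded x t0).
- move=> x t t_ t0 /contrapT uniq t_0 t_t.
  by apply: (cvg_optimal_momentum f_C2 f_convex f_superlinear beta_continuous
    u0_measurable u0_bounded t0 uniq t_0) => //; exact: cvg_cst.
- by move=> x y t t0; exact: (value_lipschitz f_C2 f_convex f_superlinear beta_continuous
    u0_measurable u0_bounded).
- by move=> x t t0 /contrapT uniq; exact: (value_is_derive f_C2 f_convex f_superlinear beta_continuous
    u0_measurable u0_bounded).
- by move=> t t0; exact: (value_time_lipschitz f_C2 f_convex f_superlinear beta_continuous
    u0_measurable u0_bounded t0).
- move=> x t t_ t0 /contrapT uniq t_0 tnt t_t.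
  exact: (cvg_value_time_quotient f_C2 f_convex f_superlinear beta_continuous
    u0_measurable u0_bounded t0 uniq t_0 tnt t_t).
- by rewrite /eta !energy0 disp0 normr0 mulr0 !addr0.
- move=> x t t0; rewrite -potentialE.
  exact: (value_initial f_C2 f_convex f_superlinear beta_continuous
    u0_measurable u0_bounded x t0).
- by move=> x t; have [] := bphi x t.
- by move=> x t; have [] := bphi x t.
- by move=> x t; have [] := bphi x t.
Qed.

End Assembly.

Theorem theorem4p5 (R : realType) (f alpha u0 : R -> R)
  (f_C2 : C2 f) (f_convex : strictly_convex f) (f_superlinear : superlinear f)
  (alpha_Linfty : Linfty_halfline alpha)
  (u0_measurable : lebesgue_measurable_fun setT u0)
  (u0_bounded : exists M : R, forall x, `|u0 x| <= M) :
  let beta := primitive alpha in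
  let F := Ffun f beta u0 in
  let u := ufun f beta u0 in
  {ae (@lebesgue_measure R \x @lebesgue_measure R)%E, forall p : R * R,
     0 < p.2 -> exists! y : R, is_minimizer (fun z => F p.1 z p.2) y} /\
  forall phi : R * R -> R, test_function phi ->
    \lint_(t in `]0, +oo[) \lint_(x in setT)
       (u x t * derive1 (fun s => phi (x, s)) t
        + f (u x t) * derive1 (fun z => phi (z, t)) x)
    + \lint_(x in setT) (u0 x * phi (x, 0))
    = - \lint_(t in `]0, +oo[) \lint_(x in setT)
          (alpha t * u x t * phi (x, t)).
Proof.
move=> beta F u; have [M u0M] := u0_bounded.
have [a [ma a0 mv va]] := Linfty_halfline_truncation alpha_Linfty.
set v := alpha \_ `[0, +oo[ in mv va.
have vE t : 0 <= t -> v t = alpha t.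
  by move=> t0; rewrite /v /patch mem_set//= in_itv/= t0.
have betaE : beta = oriented_integral a.
  apply/funext => t; rewrite /beta /primitive /oriented_integral.
  have [t0|t0] := leP 0 t.
    transitivity (\lint_(s in `[0, t]) v s).
      by apply: eq_lint => s; rewrite /= in_itv/= => /andP[s0 _]; rewrite vE.
    apply: ae_eq_lint => //; [exact: measurable_itv_lebesgue|exact: ma.1].
  rewrite set_itv_ge ?bnd_simp -?ltNge//.
  rewrite [LHS]Rintegral_set0 (@eq_lint _ _ _ (fun=> 0)); last first.
    by move=> s /=; rewrite in_itv/= => /andP[_ /a0].
  by rewrite lint_cst_segment ?mul0r ?oppr0// ltW.
have cbeta : continuous beta by rewrite betaE; exact: continuous_oriented_integral.
split.
  have [Z [mZ Z0 ZP]] :=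
    ae_unique_minimizer f_C2 f_convex f_superlinear cbeta u0_measurable u0M.
  exists Z; split; [exact: mZ|exact: Z0|] => -[x t] /= notuniq.
  apply: ZP => /= uniq; apply: notuniq => t0; have {}uniq := uniq t0.
  have -> : (fun z => F x z t) = cost f beta u0 x t.
    by apply/funext => z; rewrite /F costE.
  exists (largest_minimizer f beta u0 x t); split.
    exact: (largest_minimizerP f_C2 f_convex f_superlinear cbeta u0_measurable u0M x t0).1.
  by move=> y /uniq.
move=> phi /test_function_extension[phix [phit [X [T [B []]]]]].
move=> [X0 T0] [cphi cphix cphit] [dx dt] [sx st] bphi.
set psi := half_extension phi in cphi dx dt sx st bphi.
have sx' x t : X <= `|x| -> psi x t = 0 by move=> /(sx x t)[].
have := solution_weak_identity f_C2 f_convex f_superlinear ma u0_measurable u0M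
  X0 T0 cphi cphix cphit dx dt sx' st bphi.
rewrite -betaE; set w := optimal_momentum f beta u0 => /= -[mwp weak].
have uE x t : u x t = expR (beta t) * w x t.
  by rewrite /u /ufun /w /optimal_momentum momentumE largest_minimizerE mulrC.
have weightE t : weight a t = expR (beta t) by rewrite /weight betaE.
have outside x : ~ `[- X, X]%classic x -> X <= `|x|.
  by rewrite /= in_itv/= -ler_norml => /negP; rewrite -ltNge => /ltW.
have suppx (g : R -> R) : (forall x, X <= `|x| -> g x = 0) ->
    \lint_(x in setT) g x = \lint_(x in `[- X, X]) g x.
  by move=> g0; apply: lint_support => x; [move=> _ nx; apply: g0; exact: outside|move=> _ []].
have mw t : 0 < t -> locbdd_meas (fun x => w x t).
  exact: (locbdd_meas_optimal_momentum f_C2 f_convex f_superlinear cbeta u0_measurable u0M).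
have suppt (g : R -> R) : g 0 = 0 -> (forall t, T <= t -> g t = 0) ->
    \lint_(t in `]0, +oo[) g t = \lint_(t in `[0, T]) g t.
  move=> g0 gT; apply: lint_support => t /=; rewrite !in_itv/= ?andbT.
    by move=> t0 /negP; rewrite ltW//= -ltNge => /ltW; exact: gT.
  move=> /andP[t0 _] /negP; rewrite -leNgt => t0'.
  by have -> : t = 0 by apply/eqP; rewrite eq_le t0 t0'.
have psiE x t : 0 <= t -> phi (x, t) = psi x t by move=> t0; rewrite /psi half_extensionE.
have fluxE t : 0 < t ->
  \lint_(x in setT) (u x t * derive1 (fun s => phi (x, s)) t
        + f (u x t) * derive1 (fun z => phi (z, t)) x) =
  weighted_flux w (energy_density f beta) a phix phit X t.
  move=> t0.
  have dtE x : derive1 (fun s => phi (x, s)) t = phit x t.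
    have : is_derive t 1 (fun s => phi (x, s)) (phit x t).
      apply: (is_derive_near_eq t0 _ (dt x t t0)) => s; rewrite ltr_norml => st'.
      by rewrite psiE//; lra.
    by rewrite derive1E => -[].
  have dxE x : derive1 (fun z => phi (z, t)) x = phix x t.
    have -> : (fun z => phi (z, t)) = fun z => psi z t.
      by apply/funext => z; rewrite psiE// ltW.
    by rewrite derive1E; have [] := dx x t t0.
  rewrite suppx; last first.
    by move=> x Xx; have [_ p1 p2] := sx x t Xx; rewrite dtE dxE p1 p2; ring.
  rewrite /weighted_flux t0 /flux_pairing -lintZ_segment.
    apply: eq_lint => x _; rewrite dtE dxE uE weightE mulrDr mulrA; congr (_ + _).
    rewrite /energy_density [w x t * _]mulrC.
    have ee : expR (beta t) * expR (- beta t) = 1 by rewrite -expRD subrr expR0.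
    by rewrite mulrA mulrCA ee mulr1.
  have mc (p : R -> R -> R) : seq_continuous2 p -> locbdd_meas (fun x => p x t).
    by move=> cp; apply: locbdd_meas_continuous; exact: seq_continuous2_fst.
  apply: locbdd_measD; apply: locbdd_measM; try exact: mc; first exact: mw.
  apply: (@locbdd_meas_comp R (fun q => energy_density f beta q t)); last exact: mw.
  exact: seq_continuous2_fst (seq_continuous2_energy_density f_C2 cbeta).
have sourceE t : 0 < t ->
  \lint_(x in setT) (alpha t * u x t * phi (x, t)) = v t * (weight a t * pairing w u0 psi X t).
  move=> t0; rewrite suppx; last first.
    by move=> x Xx; rewrite psiE ?ltW// sx' ?mulr0.
  rewrite /pairing t0 mulrA -lintZ_segment.
    by apply: eq_lint => x _; rewrite psiE ?ltW// uE weightE vE ?ltW//; ring.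
  apply: locbdd_measM; first exact: mw.
  by apply: locbdd_meas_continuous; exact: seq_continuous2_fst.
have lint0 (g : R -> R) : (forall x, g x = 0) -> \lint_(x in `[- X, X]) g x = 0.
  move=> g0; have XX : - X <= X by lra.
  by rewrite (@eq_lint _ _ _ (fun=> 0))// lint_cst_segment// mul0r.
have pair0 t : T <= t -> pairing w u0 psi X t = 0.
  move=> Tt; rewrite /pairing; case: ltP => t0; apply: lint0 => x.
    by have [-> _ _] := st x t Tt; rewrite mulr0.
  by have [-> _ _] := st x 0 (le_trans Tt t0); rewrite mulr0.
have flux0 t : T <= t -> weighted_flux w (energy_density f beta) a phix phit X t = 0.
  move=> Tt; rewrite /weighted_flux; case: ifP => // _.
  rewrite /flux_pairing lint0 ?mulr0// => x.
  by have [_ -> ->] := st x t Tt; ring.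
have -> : \lint_(t in `]0, +oo[) \lint_(x in setT)
       (u x t * derive1 (fun s => phi (x, s)) t
        + f (u x t) * derive1 (fun z => phi (z, t)) x) =
    \lint_(t in `[0, T]) weighted_flux w (energy_density f beta) a phix phit X t.
  rewrite -suppt//; last by rewrite /weighted_flux ltxx.
  by apply: eq_lint => t; rewrite /= in_itv/= andbT; exact: fluxE.
have -> : \lint_(x in setT) (u0 x * phi (x, 0)) = \lint_(x in `[- X, X]) (u0 x * psi x 0).
  rewrite suppx; last by move=> x Xx; rewrite psiE// sx' ?mulr0.
  by apply: eq_lint => x _; rewrite psiE.
rewrite weak; congr (- _).
transitivity (\lint_(t in `]0, +oo[) (a t * (weight a t * pairing w u0 psi X t))).
  rewrite suppt//; first by rewrite a0 ?mul0r.
  by move=> t Tt; rewrite pair0// !mulr0.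
transitivity (\lint_(t in `]0, +oo[) (v t * (weight a t * pairing w u0 psi X t))).
  apply: ae_eq_lint.
  - exact: measurable_itv_lebesgue.
  - by apply: measurable_funM; [exact: ma.1|exact: mwp.1].
  - by apply: measurable_funM; [exact: mv|exact: mwp.1].
  - have [Z [mZ Z0 ZP]] := va; exists Z; split; [exact: mZ|exact: Z0|].
    by move=> t /= nE; apply: ZP => /= E; apply: nE; rewrite E.
by apply: eq_lint => t; rewrite /= in_itv/= andbT => /sourceE ->.
Qed.
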